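(* Let $2<p<\infty$ and let $w=(w_n)$ be a sequence of positive reals with $w_n\to0$ and $\sum_n w_n^{2p/(p-2)}=\infty$. Then the Rosenthal space $X_{p,w}$ is isomorphic to a $7.35\,(p/\log p)$-orthogonally complemented subspace of $L_p[0,1]$ (with $\log$ the natural logarithm).
   Context: For $2<p<\infty$ and a sequence $w=(w_n)$ of positive reals, $X_{p,w}$ is the space of real sequences $(x_n)$ with $(x_n)\in\ell_p$ and $(x_nw_n)\in\ell_2$, with norm $\|(x_n)\|=\max\{\|(x_n)\|_{\ell_p},\|(x_nw_n)\|_{\ell_2}\}$. For a probability space $(\Omega,\mathcal A,\mu)$ and $C>0$, an orthogonal projection $P$ on $L_2(\Omega)$ is $p$-$C$-bounded if $\|Pf\|_p\le C\|f\|_p$ for all $f\in L_2\cap L_p$; a subspace $X\subseteq L_p(\Omega)$ is $C$-orthogonally complemented if it is the $\|\cdot\|_p$-closure of $P(L_2\cap L_p)$ for some $p$-$C$-bounded orthogonal projection $P$. *)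

(* Defs.v *)
From HB Require Import structures.
From mathcomp Require Import all_boot all_order all_algebra.
From mathcomp Require Import all_classical all_reals all_analysis.
Set Implicit Arguments. Unset Strict Implicit. Unset Printing Implicit Defensive.
Import Order.TTheory GRing.Theory Num.Theory.
Import numFieldNormedType.Exports.
Local Open Scope classical_set_scope.
Local Open Scope ring_scope.

(* The probability space ([0,1], Borel, Lebesgue).  Elements of L_q are
   represented by functions R -> R, only their values on [0,1] matter,
   and they are identified up to equality a.e. on [0,1]. *)
Definition I01 (R : realType) : set R := `[0%R, 1%R].

Arguments I01 R : clear implicits.
Definition leb (R : realType) := (@lebesgue_measure R).
Arguments leb R : clear implicits.

Definition memLq (R : realType) (q : R) (f : R -> R) : Prop :=
  measurable_fun (I01 R) f /\
  (\int[leb R]_(x in I01 R) ((`|f x| `^ q)%:E) < +oo)%E.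

Definition Lqnorm (R : realType) (q : R) (f : R -> R) : \bar R :=
  ((\int[leb R]_(x in I01 R) ((`|f x| `^ q)%:E)) `^ q^-1)%E.

Definition aeq (R : realType) (f g : R -> R) : Prop :=
  {ae leb R, forall x, I01 R x -> f x = g x}.

Definition ip (R : realType) (f g : R -> R) : \bar R :=
  (\int[leb R]_(x in I01 R) ((f x * g x)%:E))%E.

Definition orth_proj (R : realType) (P : (R -> R) -> (R -> R)) : Prop :=
  [/\ forall f, memLq 2 f -> memLq 2 (P f),
      forall f g, memLq 2 f -> memLq 2 g -> aeq f g -> aeq (P f) (P g),
      forall (a : R) f g, memLq 2 f -> memLq 2 g ->
        aeq (P (fun x => a * f x + g x)) (fun x => a * P f x + P g x),
      forall f, memLq 2 f -> aeq (P (P f)) (P f)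
    & forall f g, memLq 2 f -> memLq 2 g -> ip (P f) g = ip f (P g)].

Definition p_C_bounded (R : realType) (p C : R) (P : (R -> R) -> (R -> R)) :=
  forall f, memLq 2 f -> memLq p f -> (Lqnorm p (P f) <= C%:E * Lqnorm p f)%E.

Definition closure_range (R : realType) (p : R) (P : (R -> R) -> (R -> R)) :
    set (R -> R) :=
  [set g | memLq p g /\
     forall e : R, 0 < e -> exists f, [/\ memLq 2 f, memLq p f &
        (Lqnorm p (fun x => (g x - P f x)%R) < e%:E)%E]].

Definition orth_complemented (R : realType) (p C : R) (X : set (R -> R)) :=
  exists P, [/\ orth_proj P, p_C_bounded p C P & X = closure_range p P].

Definition in_Xpw (R : realType) (p : R) (w : R ^nat) (x : R ^nat) : Prop :=
  (\sum_(0 <= n <oo) ((`|x n| `^ p)%:E) < +oo)%E /\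
  (\sum_(0 <= n <oo) (((x n * w n) ^+ 2)%:E) < +oo)%E.

Definition Xpw_norm (R : realType) (p : R) (w : R ^nat) (x : R ^nat) : R :=
  Num.max ((fine (\sum_(0 <= n <oo) ((`|x n| `^ p)%:E))%E) `^ p^-1)
          ((fine (\sum_(0 <= n <oo) (((x n * w n) ^+ 2)%:E))%E) `^ (2^-1)).

Definition isomorphic_Xpw (R : realType) (p : R) (w : R ^nat) (X : set (R -> R)) :=
  exists (T : R ^nat -> (R -> R)) (c C : R), 0 < c /\ 0 < C /\ [/\
    forall x, in_Xpw p w x -> X (T x),
    forall (a : R) x y, in_Xpw p w x -> in_Xpw p w y ->
       aeq (T (fun n => a * x n + y n)) (fun t => a * T x t + T y t),
    forall x, in_Xpw p w x ->
       ((c * Xpw_norm p w x)%R%:E <= Lqnorm p (T x) /\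
        Lqnorm p (T x) <= (C * Xpw_norm p w x)%R%:E)%E
  & forall g, X g -> exists x, in_Xpw p w x /\ aeq (T x) g].

(* Main.v *)
Require Import Defs.
From HB Require Import structures.
From mathcomp Require Import all_boot all_order all_algebra.
From mathcomp Require Import all_classical all_reals all_analysis.
From mathcomp Require Import measurable_realfun ring lra.
Import Order.TTheory GRing.Theory Num.Theory.
Import numFieldNormedType.Exports.
Local Open Scope classical_set_scope.
Local Open Scope ring_scope.

Set Implicit Arguments. Unset Strict Implicit. Unset Printing Implicit Defensive.

(** Let [a_n = min (w_n) 1 ^ (2p/(p-2))] and let [tern_n] be independent symmetric
   functions on [[0,1]] with values in [{-1,0,1}] and [|tern_n| = 1] on a set of
   measure [a_n]. The projection is [P f = \sum_n c_n tern_n] with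
   [c_n = <f, tern_n> / a_n].

   For [S = \sum_n c_n tern_n] write [E|S|^p = E(S phi(S))] with
   [phi(s) = s |s|^(p-2)]. Integrating out each [tern_n] and splitting
   [(|s| + |c|)^(p-2) <= |s|^(p-2) / (1-l)^(p-2) + |c|^(p-2) / l^(p-2)] with
   [l = 1/K], [K = 7.35 p / ln p], gives Rosenthal's inequality
   [||S||_p <= K max (||S||_2, (\sum_n a_n |c_n|^p)^(1/p))]: Young's inequality
   absorbs [E|S|^(p-2)], since [(p-1) / (1-l)^(p-2) <= K^2/2]. By Bessel's inequality
   and duality (exponent [q <= 2], where symmetry gives
   [E|\sum_n d_n tern_n|^q <= \sum_n a_n |d_n|^q]) both terms of the maximum are at
   most [||f||_p]. The same inequalities show that
   [x |-> \sum_n x_n a_n^(-1/p) tern_n] is an isomorphism from [X_{p,w}] onto the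
   closure of the range of [P]. *)

(** * Expectations of sums of symmetric ternary variables, as a recursion *)

Section walk.
Variable R : realType.
Implicit Types (c a : R ^nat) (phi psi : R -> R) (s t : R) (n : nat).

(** Independence is never stated as such. The law of a partial sum [S] enters only through the
    numbers [E phi(s + S)], which obey a recursion on the number of variables; Rosenthal's
    inequality is thus proved for a recursion over the reals, and a single integral identity carries
    it to [[0,1]]. The order [p / ln p] comes from an uneven splitting. With [l] of order [ln p / p]
    the factor [(1-l)^-(p-2)] on [|s|^(p-2)] is at most [p^(1/2)], whereas [l = 1/2] would cost
    [2^(p-2)]. The large factor [l^-(p-2) = K^(p-2)] falls only on [|c|^(p-2)], where it is harmless
    because the target is [K^p]. For infinite sums the bound in [L_p] comes from Fatou's lemma,
    which asks for convergence almost everywhere. A subsequence of the partial sums suffices for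
    this, while convergence in [L_2] of the whole sequence identifies the coefficients. *)

Definition step (c a : R) phi s : R :=
  (1 - a) * phi s + a / 2 * (phi (s + c) + phi (s - c)).

(** This is [E phi(s + S)] for [S = \sum_(i < n) c_i X_i], with independent [X_i] equal to 1 and -1
    with probability [a_i / 2] each and to 0 otherwise. The starting point [s] stays free because
    the induction conditions on the variable of index 0. *)
Fixpoint walk n c a phi : R -> R :=
  if n is n'.+1 then
    step (c 0) (a 0) (walk n' (fun k => c k.+1) (fun k => a k.+1) phi)
  else phi.

Definition midconvex phi := forall s t, phi s *+ 2 <= phi (s + t) + phi (s - t).

Lemma walk_linear n c a k phi psi s :
  walk n c a (fun s => k * phi s + psi s) s =
  k * walk n c a phi s + walk n c a psi s.
Proof.
elim: n c a s => [//|n IHn] c a s /=.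
by rewrite /step !IHn; ring.
Qed.

Lemma walk_cst n c a k s : walk n c a (fun=> k) s = k.
Proof.
elim: n c a s => [//|n IHn] c a s /=.
by rewrite /step !IHn; field.
Qed.

Lemma walk_shift n c a phi t s :
  walk n c a (fun s => phi (s + t)) s = walk n c a phi (s + t).
Proof.
elim: n c a s => [//|n IHn] c a s /=.
by rewrite /step !IHn; congr (_ + _ * (walk _ _ _ _ _ + walk _ _ _ _ _)); ring.
Qed.

Lemma le_walk n c a phi psi s : (forall n, 0 <= a n <= 1) ->
  (forall s, phi s <= psi s) -> walk n c a phi s <= walk n c a psi s.
Proof.
move=> a01 le_phi; elim: n c a a01 s => [//|n IHn] c a a01 s /=.
have /andP[a0 a1] := a01 0.
have IH := IHn (fun k => c k.+1) _ (fun k => a01 k.+1).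
rewrite /step; apply: lerD; first by apply: ler_wpM2l => //; rewrite subr_ge0.
by apply: ler_wpM2l; [rewrite divr_ge0|apply: lerD].
Qed.

Lemma midconvex_walk n c a phi : (forall n, 0 <= a n <= 1) ->
  midconvex phi -> midconvex (walk n c a phi).
Proof.
move=> a01 cphi; elim: n c a a01 => [//|n IHn] c a a01 s t /=.
have /andP[a0 a1] := a01 0.
have IH := IHn (fun k => c k.+1) _ (fun k => a01 k.+1).
rewrite /step; set g := walk _ _ _ _ in IH *.
have h1 := IH s t; have h2 := IH (s + c 0) t; have h3 := IH (s - c 0) t.
have -> : s + t + c 0 = s + c 0 + t by ring.
have -> : s + t - c 0 = s - c 0 + t by ring.
have -> : s - t + c 0 = s + c 0 - t by ring.
have -> : s - t - c 0 = s - c 0 - t by ring.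
rewrite -subr_ge0.
have -> : forall x y z u v w q r m : R,
  (1 - a 0) * y + a 0 / 2 * (z + u) + ((1 - a 0) * v + a 0 / 2 * (w + q))
  - ((1 - a 0) * x + a 0 / 2 * (r + m)) *+ 2 =
  (1 - a 0) * (y + v - x *+ 2)
  + a 0 / 2 * ((z + w - r *+ 2) + (u + q - m *+ 2)) by move=> *; field.
apply: addr_ge0; first by rewrite mulr_ge0// subr_ge0.
by rewrite mulr_ge0 ?divr_ge0// addr_ge0// subr_ge0.
Qed.

Lemma le_step (c a : R) phi s : 0 <= a -> midconvex phi -> phi s <= step c a phi s.
Proof.
move=> a0 cphi; rewrite -subr_ge0 /step.
have -> : (1 - a) * phi s + a / 2 * (phi (s + c) + phi (s - c)) - phi s =
  a / 2 * (phi (s + c) + phi (s - c) - phi s *+ 2) by field.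
by rewrite mulr_ge0 ?divr_ge0// subr_ge0.
Qed.

Lemma walk_sqr n c a s :
  walk n c a (fun s => s ^+ 2) s = s ^+ 2 + \sum_(i < n) a i * c i ^+ 2.
Proof.
elim: n c a s => [|n IHn] c a s /=; first by rewrite big_ord0 addr0.
by rewrite big_ord_recl /step !IHn /= /bump /=; field.
Qed.

(** Symmetry pairs [s + c] with [s - c], so the two-point hypothesis bounds the cost of each
    variable by [a_i phi(c_i)]. The case of interest is [phi(s) = |s|^q] with [1 <= q <= 2]. *)
Lemma walk_subadditive n c a phi s : (forall n, 0 <= a n <= 1) ->
  (forall s t, phi (s + t) + phi (s - t) <= (phi s + phi t) *+ 2) ->
  walk n c a phi s <= phi s + \sum_(i < n) a i * phi (c i).
Proof.
move=> a01 sphi; elim: n c a a01 s => [|n IHn] c a a01 s /=.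
  by rewrite big_ord0 addr0.
have /andP[a0 a1] := a01 0.
have IH := IHn (fun k => c k.+1) _ (fun k => a01 k.+1).
rewrite big_ord_recl /step /= /bump /=; set S := \sum_(i < n) _.
have h1 : (1 - a 0) * walk n (fun k => c k.+1) (fun k => a k.+1) phi s <=
    (1 - a 0) * (phi s + S).
  by apply: ler_wpM2l => //; rewrite subr_ge0.
have h2 : a 0 / 2 * (walk n (fun k => c k.+1) (fun k => a k.+1) phi (s + c 0) +
    walk n (fun k => c k.+1) (fun k => a k.+1) phi (s - c 0)) <=
    a 0 / 2 * ((phi s + phi (c 0)) *+ 2 + S *+ 2).
  apply: ler_wpM2l; first by rewrite divr_ge0.
  apply: (le_trans (lerD (IH _) (IH _))).
  by have := sphi s (c 0); rewrite -/S; lra.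
apply: (le_trans (lerD h1 h2)).
by rewrite le_eqVlt; apply/orP; left; apply/eqP; field.
Qed.

(* The variables are integrated one at a time: by symmetry, only the increment
   of [phi] between [s - c n] and [s + c n] contributes. *)
Lemma walk_Stein n c a (alpha beta : R ^nat) phi s :
  (forall n, 0 <= a n <= 1) -> midconvex (fun s => s * phi s) ->
  (forall n, 0 <= alpha n) ->
  (forall n s, a n * c n / 2 * (phi (s + c n) - phi (s - c n)) <=
               alpha n * (s * phi s) + beta n) ->
  walk n c a (fun s => s * phi s) s <= s * walk n c a phi s
    + (\sum_(i < n) alpha i) * walk n c a (fun s => s * phi s) s
    + \sum_(i < n) beta i.
Proof.
move=> a01 cpsi.
elim: n c a alpha beta a01 s => [|n IHn] c a alpha beta a01 s alpha0 incr /=.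
  by rewrite !big_ord0 mul0r !addr0.
have /andP[a0 a1] := a01 0.
have b01 k : 0 <= a k.+1 <= 1 by [].
have IH s' := IHn (fun k => c k.+1) _ (fun k => alpha k.+1)
  (fun k => beta k.+1) b01 s' (fun k => alpha0 k.+1) (fun k => incr k.+1).
rewrite !big_ord_recl /=.
rewrite -[\sum_(i < n) alpha _]/(\sum_(i < n) alpha i.+1).
rewrite -[\sum_(i < n) beta _]/(\sum_(i < n) beta i.+1).
move: IH; move: (\sum_(i < n) alpha i.+1) (\sum_(i < n) beta i.+1) => A B.
set g := walk _ _ _ (fun s => s * phi s); set h := walk _ _ _ phi => IH.
(* The pointwise bound [incr 0], averaged over the remaining variables. *)
have hincr : a 0 * c 0 / 2 * (h (s + c 0) - h (s - c 0)) <= alpha 0 * g s + beta 0.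
  have := le_walk n (fun k => c k.+1) s b01 (incr 0).
  rewrite walk_linear walk_cst -/g; apply: le_trans.
  rewrite le_eqVlt; apply/orP; left; apply/eqP.
  transitivity (walk n (fun k => c k.+1) (fun k => a k.+1)
    (fun s => (a 0 * c 0 / 2) * phi (s + c 0)
      + ((- (a 0 * c 0 / 2)) * phi (s - c 0) + 0)) s).
    rewrite walk_linear (walk_linear _ _ _ _ _ (fun=> 0)) walk_cst.
    by rewrite (walk_shift _ _ _ phi (c 0)) (walk_shift _ _ _ phi (- c 0)) -/h; ring.
  by congr (walk _ _ _ _ _); apply/funext => x; ring.
(* By midconvexity, putting the variable of index 0 back does not decrease the expectation, so [g s]
   may be replaced by the expectation of the full sum. *)
have cg : g s <= step (c 0) (a 0) g s by apply: le_step => //; exact: midconvex_walk.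
have := IH s; have := IH (s + c 0); have := IH (s - c 0) => i1 i2 i3.
have j3 : (1 - a 0) * g s <= (1 - a 0) * (s * h s + A * g s + B).
  by apply: ler_wpM2l => //; rewrite subr_ge0.
have j12 : a 0 / 2 * (g (s + c 0) + g (s - c 0)) <=
    a 0 / 2 * (((s + c 0) * h (s + c 0) + A * g (s + c 0) + B)
    + ((s - c 0) * h (s - c 0) + A * g (s - c 0) + B)).
  by apply: ler_wpM2l; [rewrite divr_ge0|apply: lerD].
have k := ler_wpM2l (alpha0 0) cg.
apply: (le_trans (lerD j3 j12)).
have -> : (1 - a 0) * (s * h s + A * g s + B) + a 0 / 2 *
  ((s + c 0) * h (s + c 0) + A * g (s + c 0) + B +
   ((s - c 0) * h (s - c 0) + A * g (s - c 0) + B)) =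
  s * step (c 0) (a 0) h s + a 0 * c 0 / 2 * (h (s + c 0) - h (s - c 0))
   + A * step (c 0) (a 0) g s + B by rewrite /step; field.
lra.
Qed.

End walk.

(** * Inequalities for real powers *)

Section power_inequalities.
Variable R : realType.
Implicit Types (x y r s t u p : R).

(** Young's inequality for [u * 1] with exponents [r] and [r / (r - 1)], multiplied by [r]. *)
Lemma powR_Bernoulli u r : 1 <= r -> 0 <= u -> 1 + r * (u - 1) <= u `^ r.
Proof.
rewrite le_eqVlt => /predU1P[<- u0|r1 u0]; first by rewrite powRr1//; lra.
have r0 : 0 < r by lra.
have := @conjugate_powR R u 1 r (r / (r - 1)) u0 ler01 r0.
rewrite divr_gt0//; last by lra.
have -> : r^-1 + (r / (r - 1))^-1 = 1 by field; lra.
move=> /(_ isT erefl); rewrite powR1 div1r invf_div mulr1 => h.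
have := ler_wpM2l (ltW r0) h.
have -> : r * (u `^ r / r + (r - 1) / r) = u `^ r + (r - 1) by field; lra.
lra.
Qed.

Lemma powR_tangent x y r : 1 <= r -> 0 < x -> 0 <= y ->
  x `^ r + r * (x `^ (r - 1)) * (y - x) <= y `^ r.
Proof.
move=> r1 x0 y0; have := powR_Bernoulli r1 (divr_ge0 y0 (ltW x0)).
move=> /(ler_wpM2l (powR_ge0 x r)); rewrite -powRM ?divr_ge0 ?(ltW x0)//.
rewrite [x * (y / x)]mulrC divfK ?gt_eqF//; apply: le_trans.
have -> : x `^ r = x * x `^ (r - 1) by rewrite mulr_powRB1 ?(ltW x0)//; lra.
by rewrite le_eqVlt; apply/orP; left; apply/eqP; field; rewrite gt_eqF.
Qed.

(** The tangent inequalities at the midpoint are added; the slopes cancel. *)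
Lemma powR_midpoint x y r : 1 <= r -> 0 <= x -> 0 <= y ->
  ((x + y) / 2) `^ r *+ 2 <= x `^ r + y `^ r.
Proof.
move=> r1 x0 y0; have [m0|] := ltP 0 ((x + y) / 2).
  have h1 := powR_tangent r1 m0 x0; have h2 := powR_tangent r1 m0 y0.
  move: h1 h2; set m := (x + y) / 2 in m0 *.
  have -> : y - m = - (x - m) by rewrite /m; field.
  by rewrite mulrN; lra.
move=> m0; have -> : (x + y) / 2 = 0 by lra.
by rewrite powR0 ?mul0rn ?addr_ge0 ?powR_ge0//; lra.
Qed.

Lemma midconvex_normR_powR r : 1 <= r -> midconvex (fun s : R => `|s| `^ r).
Proof.
move=> r1 s t; have := powR_midpoint r1 (normr_ge0 (s + t)) (normr_ge0 (s - t)).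
apply: le_trans; rewrite lerMn2r /=; apply: ge0_ler_powR; first by lra.
- by rewrite nnegrE.
- by rewrite nnegrE divr_ge0 ?addr_ge0.
- rewrite ler_pdivlMr//; have := ler_normD (s + t) (s - t).
  have -> : s + t + (s - t) = s * 2 by ring.
  by rewrite normrM (ger0_norm (ler0n R 2)).
Qed.

Lemma powRD_le x y r : 0 < r <= 1 -> 0 <= x -> 0 <= y ->
  (x + y) `^ r <= x `^ r + y `^ r.
Proof.
move=> /andP[r0 r1] x0 y0.
have [->|xN0] := eqVneq x 0; first by rewrite !add0r lerDr powR_ge0.
have [->|yN0] := eqVneq y 0; first by rewrite !addr0 lerDl powR_ge0.
have {xN0}x0 : 0 < x by rewrite lt0r xN0.
have {yN0}y0 : 0 < y by rewrite lt0r yN0.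
have z0 := addr_gt0 x0 y0.
have h z : 0 < z -> z <= x + y -> z / (x + y) * (x + y) `^ r <= z `^ r.
  move=> zp zl; have -> : z `^ r = (z / (x + y)) `^ r * (x + y) `^ r.
    by rewrite -powRM ?divr_ge0 ?ltW// divfK ?gt_eqF.
  apply: ler_wpM2r; first exact: powR_ge0.
  by apply: ger1_powR => //; rewrite divr_gt0//= ler_pdivrMr// mul1r.
have -> : (x + y) `^ r = x / (x + y) * (x + y) `^ r + y / (x + y) * (x + y) `^ r.
  by field; rewrite gt_eqF.
by apply: lerD; apply: h => //; lra.
Qed.

(** By the parallelogram identity [(s + t)^2] and [(s - t)^2] have mean [s^2 + t^2]. The power mean
    inequality with exponent [2 / r >= 1] passes to the powers [r], and the power [r / 2 <= 1] is
    subadditive. *)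
Lemma normR_powR_subadditive r s t : 1 <= r <= 2 ->
  `|s + t| `^ r + `|s - t| `^ r <= (`|s| `^ r + `|t| `^ r) *+ 2.
Proof.
move=> /andP[r1 r2].
have rN0 : r != 0 by rewrite gt_eqF// (lt_le_trans ltr01).
have sqE (z : R) : `|z| `^ r = (z ^+ 2) `^ (r / 2).
  have -> : z ^+ 2 = `|z| `^ 2 by rewrite powR_mulrn ?normr_ge0// real_normK ?num_real.
  by rewrite -powRrM; congr (_ `^ _); field.
have q1 : 1 <= 2 / r by rewrite ler_pdivlMr; lra.
have h := powR_midpoint q1 (powR_ge0 ((s + t) ^+ 2) (r / 2))
  (powR_ge0 ((s - t) ^+ 2) (r / 2)).
have e z : 0 <= z -> (z `^ (r / 2)) `^ (2 / r) = z.
  move=> z0; rewrite -powRrM; have -> : r / 2 * (2 / r) = 1 by field.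
  exact: powRr1.
rewrite !e ?sqr_ge0// -!sqE in h.
have {h} : ((`|s + t| `^ r + `|s - t| `^ r) / 2) `^ (2 / r) <= s ^+ 2 + t ^+ 2.
  rewrite -[leLHS]mulr1n; have : (s + t) ^+ 2 + (s - t) ^+ 2 = (s ^+ 2 + t ^+ 2) *+ 2.
    by ring.
  by move=> E; rewrite E in h; move: h; rewrite lerMn2r.
set m := (_ / 2); have m0 : 0 <= m by rewrite divr_ge0 ?addr_ge0 ?powR_ge0.
move=> h.
have : m <= `|s| `^ r + `|t| `^ r.
  have -> : m = (m `^ (2 / r)) `^ (r / 2).
    rewrite -powRrM; have -> : 2 / r * (r / 2) = 1 by field.
    by rewrite powRr1.
  rewrite !sqE; apply: le_trans (powRD_le _ _ _); rewrite ?sqr_ge0//; last by lra.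
  apply: ge0_ler_powR => //; first by lra.
  - by rewrite nnegrE powR_ge0.
  - by rewrite nnegrE addr_ge0 ?sqr_ge0.
by rewrite /m; lra.
Qed.

(** The derivative of [x |x|^r] is [(r + 1) |x|^r], at most [(r + 1) M^r] on [[-M, M]]. Tangent
    lines replace the mean value theorem when the signs agree; for opposite signs each term is at
    most [M^r] times the absolute value of its argument. *)
Lemma signed_powR_lip (r x y M : R) : 0 <= r -> y <= x -> `|x| <= M -> `|y| <= M ->
  x * `|x| `^ r - y * `|y| `^ r <= (r + 1) * (x - y) * M `^ r.
Proof.
move=> r0.
have mono (z : R) : `|z| <= M -> `|z| `^ r <= M `^ r.
  move=> zM; have M0 := le_trans (normr_ge0 z) zM.
  by apply: ge0_ler_powR; rewrite ?nnegrE.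
have pos : forall x y : R, 0 <= y -> y <= x -> `|x| <= M ->
    x * `|x| `^ r - y * `|y| `^ r <= (r + 1) * (x - y) * M `^ r.
  move=> {x y} x y y0 yx xM; have x0 := le_trans y0 yx.
  have := mono _ xM; rewrite !ger0_norm// => xMr.
  have [x00|x00] := eqVneq x 0.
    have y00 : y = 0 by lra.
    by rewrite x00 y00 !subrr mulr0 mul0r.
  have xp : 0 < x by rewrite lt0r x00.
  have r1 : 1 <= r + 1 by lra.
  have := powR_tangent r1 xp y0.
  have -> : r + 1 - 1 = r by ring.
  rewrite -!(@mulr_powRB1 _ _ (r + 1)) ?(ltW xp)//; try lra.
  have -> : r + 1 - 1 = r by ring.
  have := ler_wpM2l (_ : 0 <= (r + 1) * (x - y)) xMr.
  by move=> /(_ (mulr_ge0 _ _)) h; move: (h ltac:(lra) ltac:(lra)); nra.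
move=> yx xM yM; have [y0|y0] := leP 0 y; first exact: pos.
have [x0|x0] := leP x 0.
  have := pos (- y) (- x); rewrite !normrN => h.
  by have := h ltac:(lra) ltac:(lra) yM; lra.
have hx := ler_wpM2l (ltW x0) (mono _ xM).
have hy := ler_wpM2l (_ : 0 <= - y) (mono _ yM).
have {}hy := hy ltac:(lra).
have M0 : 0 <= M `^ r := powR_ge0 _ _.
have : 0 <= r * (x - y) * M `^ r by rewrite !mulr_ge0// subr_ge0.
lra.
Qed.

(** [x + y] is the convex combination of [x / (1 - l)] and [y / l] with weights [1 - l] and [l],
    hence at most the larger of the two. The argument covers exponents below 1, which occur for
    [2 < p < 3]. *)
Lemma powR_split (x y l r : R) : 0 <= r -> 0 < l < 1 -> 0 <= x -> 0 <= y ->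
  (x + y) `^ r <= ((1 - l)^-1) `^ r * x `^ r + (l^-1) `^ r * y `^ r.
Proof.
move=> r0 /andP[l0 l1] x0 y0; have l1' : 0 < 1 - l by lra.
rewrite -!powRM//; try by rewrite invr_ge0 ltW.
have u0 : 0 <= (1 - l)^-1 * x by rewrite mulr_ge0// invr_ge0 ltW.
have v0 : 0 <= l^-1 * y by rewrite mulr_ge0// invr_ge0 ltW.
have E : x + y = (1 - l) * ((1 - l)^-1 * x) + l * (l^-1 * y).
  by rewrite !mulrA !mulfV ?gt_eqF// !mul1r.
have mono : forall z, 0 <= z -> x + y <= z -> (x + y) `^ r <= z `^ r.
  by move=> z z0 h; apply: ge0_ler_powR => //; rewrite nnegrE// addr_ge0.
have [uv|vu] := leP ((1 - l)^-1 * x) (l^-1 * y).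
  apply: (@le_trans _ _ ((l^-1 * y) `^ r)); last by rewrite lerDr powR_ge0.
  by apply: mono => //; rewrite E; nra.
apply: (@le_trans _ _ (((1 - l)^-1 * x) `^ r)); last by rewrite lerDl powR_ge0.
by apply: mono => //; rewrite E; nra.
Qed.

(** Young's inequality for [(x / Q)^(p-2) * 1] with exponents [p / (p - 2)] and [p / 2]; equality
    holds at [x = Q]. *)
Lemma powR_Young p x Q : 2 < p -> 0 <= x -> 0 < Q ->
  x `^ (p - 2) <= (1 - 2 / p) / Q ^+ 2 * x `^ p + 2 / p * Q `^ (p - 2).
Proof.
move=> p2 x0 Q0; have p0 : 0 < p by lra.
have xQ0 : 0 <= x / Q by rewrite divr_ge0// ltW.
have := @conjugate_powR R ((x / Q) `^ (p - 2)) 1 (p / (p - 2)) (p / 2)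
  (powR_ge0 _ _) ler01.
rewrite !divr_gt0//; last by lra.
have -> : (p / (p - 2))^-1 + (p / 2)^-1 = 1 by field; lra.
move=> /(_ isT isT erefl); rewrite mulr1 powR1 -powRrM.
have -> : (p - 2) * (p / (p - 2)) = p by field; lra.
move=> /(ler_wpM2l (powR_ge0 Q (p - 2))).
rewrite -powRM ?(ltW Q0)// [Q * (x / Q)]mulrC divfK ?gt_eqF// => /le_trans; apply.
have -> : Q `^ (p - 2) = Q `^ p / Q ^+ 2.
  rewrite -powR_mulrn ?(ltW Q0)// -powRB//.
  by apply/implyP => _; rewrite gt_eqF.
have -> : x `^ p = (x / Q) `^ p * Q `^ p by rewrite -powRM ?(ltW Q0)// divfK ?gt_eqF.
by rewrite le_eqVlt; apply/orP; left; apply/eqP; field; lra.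
Qed.

End power_inequalities.

(** * Rosenthal's inequality with constant [7.35 p / ln p] *)

Section Rosenthal_inequality.
Variable R : realType.
Implicit Types (c a : R ^nat) (p B : R).

Definition Rosenthal_cst p : R := (735%:R / 100%:R) * (p / ln p).

Lemma Rosenthal_cst_gt2 p : 2 < p -> 2 < Rosenthal_cst p.
Proof.
move=> p2; have p0 : 0 < p by lra.
have L0 : 0 < ln p by apply: ln_gt0; lra.
have h : 1 < p / ln p by rewrite ltr_pdivlMr// mul1r ln_sublinear.
by rewrite /Rosenthal_cst; lra.
Qed.

(** For [l = 1/K < 1/2] one has [1 / (1 - l) <= exp (2 l)], and
    [2 l p = (200/735) ln p <= ln p / 2]; so the left side is at most [p^(3/2) = z^6] with
    [z = p^(1/4)]. On the right, [ln p = 4 ln z < 4 z] gives [p^2 / (ln p)^2 >= z^6 / 16], and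
    [7.35^2 / 2 > 16]. *)
Lemma Rosenthal_cst_bound p : 2 < p ->
  (p - 1) * ((1 - (Rosenthal_cst p)^-1)^-1) `^ (p - 2) <= Rosenthal_cst p ^+ 2 / 2.
Proof.
move=> p2; have p0 : 0 < p by lra.
have L0 : 0 < ln p by apply: ln_gt0; lra.
have K2 := Rosenthal_cst_gt2 p2.
set K := Rosenthal_cst p in K2 *; set l := K^-1.
have l0 : 0 < l by rewrite invr_gt0; lra.
have lp : l * p = 100%:R / 735%:R * ln p.
  by rewrite /l /K /Rosenthal_cst; field; rewrite !gt_eqF.
have l2 : l < 2^-1 by rewrite /l ltf_pV2// posrE; lra.
set z := p `^ (4%:R^-1); have z0 : 0 < z by exact: powR_gt0.
have z4 : z ^+ 4 = p.
  by rewrite -powR_mulrn ?(ltW z0)// -powRrM mulVf// powRr1// ltW.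
have z2 : z ^+ 2 = expR (ln p / 2).
  by rewrite -powR_mulrn ?(ltW z0)// -powRrM /powR gt_eqF//; congr expR; field.
have Lz : ln p < 4%:R * z by have := ln_sublinear z0; rewrite ln_powR; lra.
have A : ((1 - l)^-1) `^ (p - 2) <= z ^+ 2.
  apply: (@le_trans _ _ ((expR (2 * l)) `^ (p - 2))).
    apply: ge0_ler_powR; rewrite ?nnegrE ?expR_ge0 ?invr_ge0//; try lra.
    apply: le_trans (expR_ge1Dx _).
    rewrite -[leLHS]div1r ler_pdivrMr; nra.
  rewrite -expRM z2 ler_expR; nra.
have h : (p - 1) * ((1 - l)^-1) `^ (p - 2) <= z ^+ 6.
  apply: (@le_trans _ _ (p * z ^+ 2)); last by rewrite -{1}z4 -exprD.
  by apply: ler_pM => //; [lra|exact: powR_ge0|lra].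
apply: (le_trans h).
have -> : K ^+ 2 / 2 = (735%:R / 100%:R) ^+ 2 / 2 * (p ^+ 2 / (ln p) ^+ 2).
  by rewrite /K /Rosenthal_cst; field; rewrite gt_eqF.
rewrite mulrA ler_pdivlMr ?exprn_gt0//.
have -> : p ^+ 2 = z ^+ 6 * z ^+ 2 by rewrite -exprD -z4 -exprM.
rewrite [leRHS]mulrCA; apply: ler_wpM2l; first by rewrite exprn_ge0 ?ltW.
have := ler_pM (ltW L0) (ltW L0) (ltW Lz) (ltW Lz); rewrite -!expr2.
have : 0 <= z ^+ 2 by rewrite exprn_ge0 ?ltW.
have -> : (4%:R * z) ^+ 2 = 16%:R * z ^+ 2 by ring.
lra.
Qed.

Lemma signed_powRE p (s : R) : 2 < p -> s * (s * `|s| `^ (p - 2)) = `|s| `^ p.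
Proof.
move=> p2; rewrite mulrA -expr2 -[s ^+ 2]real_normK ?num_real//.
rewrite -powR_mulrn// -powRD; first by congr (_ `^ _); ring.
by apply/implyP => /eqP; lra.
Qed.

(** The end points lie in [[-M, M]] with [M = |s| + |c|] and are [2 |c|] apart, so the Lipschitz
    bound gives [(p - 1) c^2 M^(p-2)]; then [M^(p-2)] is split. The sign of [c] only decides the
    order of the end points. *)
Lemma signed_powR_incr p (s c l : R) : 2 < p -> 0 < l < 1 ->
  c / 2 * ((s + c) * `|s + c| `^ (p - 2) - (s - c) * `|s - c| `^ (p - 2)) <=
  (p - 1) * (((1 - l)^-1) `^ (p - 2) * (c ^+ 2 * `|s| `^ (p - 2))
    + (l^-1) `^ (p - 2) * `|c| `^ p).
Proof.
move=> p2 l01; have r0 : 0 <= p - 2 by lra.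
have -> : `|c| `^ p = c ^+ 2 * `|c| `^ (p - 2) by rewrite -signed_powRE// mulrA.
apply: (@le_trans _ _ ((p - 1) * (c ^+ 2 * (`|s| + `|c|) `^ (p - 2)))); last first.
  apply: ler_wpM2l; first by lra.
  rewrite (mulrCA _ (c ^+ 2)) (mulrCA _ (c ^+ 2)) -mulrDr.
  by apply: ler_wpM2l; [exact: sqr_ge0|exact: powR_split].
have M1 : `|s + c| <= `|s| + `|c| by exact: ler_normD.
have M2 : `|s - c| <= `|s| + `|c| by exact: ler_normB.
have [c0|c0] := leP 0 c.
  have := signed_powR_lip r0 (_ : s - c <= s + c) M1 M2.
  move=> /(_ ltac:(lra)) /(ler_wpM2l (_ : 0 <= c / 2)).
  move=> /(_ ltac:(lra)) /le_trans; apply.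
  by rewrite le_eqVlt; apply/orP; left; apply/eqP; field.
have := signed_powR_lip r0 (_ : s + c <= s - c) M2 M1.
move=> /(_ ltac:(lra)) /(ler_wpM2l (_ : 0 <= - c / 2)).
move=> /(_ ltac:(lra)) h.
have -> : forall u v : R, c / 2 * (u - v) = - c / 2 * (v - u) by move=> *; field.
apply: (le_trans h).
by rewrite le_eqVlt; apply/orP; left; apply/eqP; field.
Qed.

(** With [Q = K B], the sums of [alpha] and [beta] are at most [1/2 - 1/p] and [(1/2 + 1/p) Q^p].
    Starting from [s = 0], this gives [E <= (1/2 - 1/p) E + (1/2 + 1/p) Q^p], which is exactly
    [E <= Q^p]. *)
Lemma walk_Rosenthal p n c a B : 2 < p -> (forall n, 0 <= a n <= 1) -> 0 < B ->
  \sum_(i < n) a i * c i ^+ 2 <= B ^+ 2 ->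
  \sum_(i < n) a i * `|c i| `^ p <= B `^ p ->
  walk n c a (fun s => `|s| `^ p) 0 <= (Rosenthal_cst p * B) `^ p.
Proof.
move=> p2 a01 B0 s2 sp.
have p0 : 0 < p by lra.
have K2 := Rosenthal_cst_gt2 p2; have := Rosenthal_cst_bound p2.
set K := Rosenthal_cst p in K2 *; set A := (_^-1) `^ _ => KA.
have A0 : 0 <= A by exact: powR_ge0.
have K0 : 0 < K by lra.
set Q := K * B; have Q0 : 0 < Q by exact: mulr_gt0.
have l01 : 0 < K^-1 < 1 by rewrite invr_gt0 K0/= invf_lt1//; lra.
(* With [KA] this yields [p - 1 <= K^2 / 2], used for the terms in [|c|^p]. *)
have A1 : 1 <= A.
  have h1 : 1 <= (1 - K^-1)^-1 by rewrite invf_ge1; lra.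
  by have := ler_powR h1 (_ : 0 <= p - 2); rewrite powRr0; apply; lra.
(* Young's inequality at scale [Q] sends the part of the increment in [|s|^(p-2)] to [alpha] and to
   the first term of [beta]; the part in [|c|^p] is the second term of [beta]. *)
pose alpha n := a n * c n ^+ 2 * ((p - 1) * A * ((1 - 2 / p) / Q ^+ 2)).
pose beta n := a n * c n ^+ 2 * ((p - 1) * A * (2 / p * Q `^ (p - 2)))
  + a n * `|c n| `^ p * ((p - 1) * K `^ (p - 2)).
have psiE : (fun s : R => s * (s * `|s| `^ (p - 2))) = fun s => `|s| `^ p.
  by apply/funext => s; exact: signed_powRE.
have a0 m : 0 <= a m by case/andP: (a01 m).
have p21 : 0 <= 1 - 2 / p by rewrite subr_ge0 ler_pdivrMr//; lra.
have p10 : 0 <= p - 1 by lra.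
have Q20 : 0 <= (Q ^+ 2)^-1 by rewrite invr_ge0 sqr_ge0.
have alpha0 m : 0 <= alpha m.
  by apply: mulr_ge0; [rewrite mulr_ge0 ?sqr_ge0|rewrite !mulr_ge0].
have incr m (s : R) : a m * c m / 2 * ((s + c m) * `|s + c m| `^ (p - 2)
    - (s - c m) * `|s - c m| `^ (p - 2)) <=
    alpha m * (s * (s * `|s| `^ (p - 2))) + beta m.
  rewrite signed_powRE//.
  have := signed_powR_incr s (c m) p2 l01.
  move=> /(ler_wpM2l (a0 m)); rewrite invrK -/A => h.
  rewrite -2![a m * _ * _]mulrA; apply: (le_trans h) => {h}.
  have := powR_Young p2 (normr_ge0 s) Q0.
  move=> /(ler_wpM2l (_ : 0 <= a m * c m ^+ 2 * ((p - 1) * A))).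
  move=> /(_ (mulr_ge0 (mulr_ge0 (a0 m) (sqr_ge0 _)) (mulr_ge0 _ A0))).
  move=> /(_ ltac:(lra)); rewrite /alpha /beta; lra.
have := @walk_Stein _ n c a alpha beta (fun s => s * `|s| `^ (p - 2)) 0 a01.
rewrite psiE => /(_ (midconvex_normR_powR _) alpha0 incr).
move=> /(_ ltac:(lra)); rewrite mul0r add0r.
set E := walk _ _ _ _ _.
have E0 : 0 <= E.
  by rewrite -(walk_cst n c a 0 0); apply: le_walk => // s; exact: powR_ge0.
have QB : (p - 1) * A * B ^+ 2 <= Q ^+ 2 / 2.
  have := ler_wpM2r (sqr_ge0 B) KA.
  by have -> : K ^+ 2 / 2 * B ^+ 2 = Q ^+ 2 / 2 by rewrite /Q; field.
have QE x : 0 < x -> x `^ p = x `^ (p - 2) * x ^+ 2.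
  move=> x0; rewrite -powR_mulrn ?(ltW x0)// -powRD; first by congr (_ `^ _); ring.
  by apply/implyP => _; rewrite gt_eqF.
have sumA : \sum_(i < n) alpha i <= (1 - 2 / p) / 2.
  rewrite -mulr_suml; apply: (@le_trans _ _ (B ^+ 2 * ((p - 1) * A * ((1 - 2 / p) / Q ^+ 2)))).
    apply: ler_wpM2r => //.
    by rewrite !mulr_ge0.
  have -> : B ^+ 2 * ((p - 1) * A * ((1 - 2 / p) / Q ^+ 2)) =
    (p - 1) * A * B ^+ 2 * ((1 - 2 / p) / Q ^+ 2) by ring.
  apply: (le_trans (ler_wpM2r _ QB)).
    by rewrite mulr_ge0.
  by rewrite le_eqVlt; apply/orP; left; apply/eqP; field; rewrite !gt_eqF.
have sumB : \sum_(i < n) beta i <= (1 / p + 1 / 2) * Q `^ p.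
  rewrite big_split /= -!mulr_suml [leRHS]mulrDl; apply: lerD.
    apply: (@le_trans _ _ (B ^+ 2 * ((p - 1) * A * (2 / p * Q `^ (p - 2))))).
      apply: ler_wpM2r => //.
      by rewrite !mulr_ge0 ?invr_ge0 ?powR_ge0 ?(ltW p0).
    have -> : B ^+ 2 * ((p - 1) * A * (2 / p * Q `^ (p - 2))) =
      (p - 1) * A * B ^+ 2 * (2 / p * Q `^ (p - 2)) by ring.
    apply: (le_trans (ler_wpM2r _ QB)).
      by rewrite !mulr_ge0 ?invr_ge0 ?powR_ge0 ?(ltW p0).
    rewrite QE//.
    by rewrite le_eqVlt; apply/orP; left; apply/eqP; field; rewrite !gt_eqF.
  have KK : (p - 1) * K `^ (p - 2) <= 1 / 2 * K `^ p.
    rewrite (QE K)// mulrCA mulrC; apply: ler_wpM2l; first exact: powR_ge0.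
    nra.
  apply: (le_trans (ler_pM _ _ sp KK)).
  - by apply: sumr_ge0 => i _; rewrite mulr_ge0// powR_ge0.
  - by rewrite mulr_ge0 ?powR_ge0//; lra.
  - by rewrite /Q powRM ?(ltW K0) ?(ltW B0)// mulrCA [K `^ p * _]mulrC.
have := ler_wpM2r E0 sumA.
have pE : 2 / p = 2 * (1 / p) by field; rewrite gt_eqF.
have ip0 : 0 < 1 / p by rewrite divr_gt0.
rewrite pE in sumA *; move: (1 / p) ip0 sumB => v v0 sumB h1 h2.
have : (v + 1 / 2) * E <= (v + 1 / 2) * Q `^ p by lra.
by rewrite ler_pM2l//; lra.
Qed.

End Rosenthal_inequality.

(** * Explicit ternary functions on an interval *)

Section ternary_functions.
Variable R : realType.
Implicit Types (c a : R ^nat) (phi : R -> R) (l h s t : R) (n N : nat).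

(* The interval [[l, l + h[] is cut into consecutive pieces of relative lengths
   [a 0 / 2], [a 0 / 2] and [1 - a 0], on which the function of index [0] takes
   the values [1], [-1] and [0]; the function of index [n.+1] is obtained by
   cutting each of these pieces again. *)
Fixpoint ternary n a l h t : R :=
  if n is n'.+1 then
    let a' := fun k => a k.+1 in
    if t < l + a 0 / 2 * h then ternary n' a' l (a 0 / 2 * h) t
    else if t < l + a 0 * h then
      ternary n' a' (l + a 0 / 2 * h) (a 0 / 2 * h) t
    else ternary n' a' (l + a 0 * h) ((1 - a 0) * h) t
  else if t < l + a 0 / 2 * h then 1 else if t < l + a 0 * h then -1 else 0.

Lemma measurable_ternary n a l h : measurable_fun setT (ternary n a l h).
Proof.
have mlt (k : R) : measurable_fun [set: R] (fun t => t < k).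
  by apply: measurable_fun_ltr; [exact: measurable_id|exact: measurable_cst].
elim: n a l h => [|n IHn] a l h /=.
  by do 2 (apply: measurable_fun_ifT => //).
by apply: measurable_fun_ifT => //; apply: measurable_fun_ifT.
Qed.

Lemma normr_ternary_le1 n a l h t : `|ternary n a l h t| <= 1.
Proof.
elim: n a l h => [|n IHn] a l h /=.
  by case: ifP => _; [|case: ifP => _]; rewrite ?normrN ?normr1 ?normr0.
by case: ifP => _ //; case: ifP.
Qed.

Definition ternary_sum N c a l h t : R := \sum_(i < N) c i * ternary i a l h t.

Lemma measurable_ternary_sum N c a l h :
  measurable_fun setT (ternary_sum N c a l h).
Proof.
apply: measurable_sum => i; apply: measurable_funM => //.
exact: measurable_ternary.
Qed.

Lemma ternary_sumS N c a l h t :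
  ternary_sum N.+1 c a l h t =
  let c' := fun k => c k.+1 in let a' := fun k => a k.+1 in
  if t < l + a 0 / 2 * h then c 0 + ternary_sum N c' a' l (a 0 / 2 * h) t
  else if t < l + a 0 * h then
    - c 0 + ternary_sum N c' a' (l + a 0 / 2 * h) (a 0 / 2 * h) t
  else ternary_sum N c' a' (l + a 0 * h) ((1 - a 0) * h) t.
Proof.
rewrite /ternary_sum big_ord_recl /= /bump /=.
by case: ifP => _; [|case: ifP => _]; rewrite ?mulr1 ?mulrN1 ?mulr0 ?add0r.
Qed.

(** This identity carries the independence: on each of the three pieces the function of index 0 is
    constant and the later ones are the same construction on a shorter interval. Hence the induction
    over all [l] and [h], with [h = 0] allowed since pieces may be empty. *)
Lemma integral_ternary_sum N c a phi s l h :
  (forall n, 0 <= a n <= 1) -> 0 <= h -> measurable_fun setT phi ->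
  (forall x, 0 <= phi x) ->
  (\int[leb R]_(t in `[l, (l + h)%R[) (phi (s + ternary_sum N c a l h t))%:E =
   (h * walk N c a phi s)%:E)%E.
Proof.
move=> a01 h0 mphi phi0.
elim: N c a s l h a01 h0 => [|N IHN] c a s l h a01 h0.
  rewrite (eq_integral (cst (phi s)%:E)); last first.
    by move=> t _; rewrite /ternary_sum big_ord0 addr0.
  rewrite integral_cst//= lebesgue_measure_itv/= lte_fin ltrDl.
  have [h1|] := ltP 0 h; first by rewrite -EFinB -EFinM; congr (_%:E); ring.
  move=> h1; have -> : h = 0 by lra.
  by rewrite mule0 mul0r.
have /andP[a0 a1] := a01 0.
have ha : 0 <= a 0 / 2 * h by rewrite mulr_ge0 ?divr_ge0.
have hb : 0 <= (1 - a 0) * h by rewrite mulr_ge0// subr_ge0.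
have ab : a 0 * h = a 0 / 2 * h + a 0 / 2 * h by field.
have bh : h = a 0 * h + (1 - a 0) * h by ring.
set x1 := l + a 0 / 2 * h; set x2 := l + a 0 * h.
have lx1 : l <= x1 by rewrite /x1; lra.
have x12 : x1 <= x2 by rewrite /x1 /x2; lra.
have x2h : x2 <= l + h by rewrite /x2; lra.
have mF k c' a' l' h' : measurable_fun [set: R]
    (fun t => (phi (s + ternary_sum k c' a' l' h' t))%:E).
  apply/measurable_EFinP; apply: (measurableT_comp mphi).
  by apply: measurable_funD => //; exact: measurable_ternary_sum.
have -> : `[l, l + h[%classic =
    (`[l, x1[%classic `|` `[x1, x2[%classic) `|` `[x2, l + h[%classic.
  by rewrite -!itv_bndbnd_setU ?bnd_simp// (le_trans lx1).
have F0 t : (0 <= (phi (s + ternary_sum N.+1 c a l h t))%:E)%E by rewrite lee_fin.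
rewrite ge0_integral_setU//=; first last.
- by apply/disj_setPS => t [[|]]; rewrite /= !in_itv/=; lra.
- exact: measurable_funTS (mF _ _ _ _ _).
- exact: measurableU.
rewrite ge0_integral_setU//=; first last.
- by apply/disj_setPS => t []; rewrite /= !in_itv/=; lra.
- exact: measurable_funTS (mF _ _ _ _ _).
set c' := fun k => c k.+1; set a' := fun k => a k.+1.
have a01' k : 0 <= a' k <= 1 by exact: a01.
have E1 : (\int[leb R]_(t in `[l, x1[) (phi (s + ternary_sum N.+1 c a l h t))%:E =
    (a 0 / 2 * h * walk N c' a' phi (s + c 0))%:E)%E.
  rewrite -(IHN c' a' (s + c 0) l)//; apply: eq_integral => t.
  by rewrite inE /= in_itv/= => /andP[lt tx]; rewrite ternary_sumS -/x1 tx /= addrA.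
have E2 : (\int[leb R]_(t in `[x1, x2[) (phi (s + ternary_sum N.+1 c a l h t))%:E =
    (a 0 / 2 * h * walk N c' a' phi (s - c 0))%:E)%E.
  rewrite -(IHN c' a' (s - c 0) x1)//.
  have -> : x1 + a 0 / 2 * h = x2 by rewrite /x1 /x2; lra.
  apply: eq_integral => t; rewrite inE /= in_itv/= => /andP[lt tx].
  by rewrite ternary_sumS -/x1 -/x2 tx ltNge lt /= addrA.
have E3 : (\int[leb R]_(t in `[x2, (l + h)%R[)
      (phi (s + ternary_sum N.+1 c a l h t))%:E =
    ((1 - a 0) * h * walk N c' a' phi s)%:E)%E.
  rewrite -(IHN c' a' s x2)//.
  have -> : x2 + (1 - a 0) * h = l + h by rewrite /x2; lra.
  apply: eq_integral => t; rewrite inE /= in_itv/= => /andP[lt tx].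
  by rewrite ternary_sumS -/x1 -/x2 !ltNge lt (le_trans x12 lt).
by rewrite E1 E2 E3 -!EFinD; congr (_%:E); rewrite /= /step -/c' -/a'; field.
Qed.

End ternary_functions.

(** * The spaces [L_q] of the unit interval and the inner product *)

Section Lq_unit_interval.
Variable R : realType.
Implicit Types (f g h : R -> R) (q r : R).
Local Notation D := (I01 R).
Local Notation mu := (leb R).

Definition Iq q f : \bar R := (\int[mu]_(x in D) (`|f x| `^ q)%:E)%E.

Definition ipr f g : R := fine (ip f g).

Lemma measurable_I01 : measurable (D : set R).
Proof. exact: measurable_itv. Qed.
Local Hint Resolve measurable_I01 : core.

Lemma leb_I01 : mu D = 1%:E.
Proof. by rewrite /leb /I01 lebesgue_measure_itv/= lte_fin ltr01 oppr0 adde0. Qed.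

Lemma ae_lebS (P Q : R -> Prop) : (forall x, P x -> Q x) ->
  (\forall x \ae leb R, P x) -> \forall x \ae leb R, Q x.
Proof. exact: (@filterS _ _ (ae_filter_ringOfSetsType (@lebesgue_measure R))). Qed.

Lemma measurable_normr_powR q f : measurable_fun D f ->
  measurable_fun D (fun x => (`|f x| `^ q)%:E).
Proof.
move=> mf; apply/measurable_EFinP.
apply: (measurableT_comp (measurable_powR q)).
exact: (measurableT_comp (@normr_measurable R setT) mf).
Qed.

Lemma Iq_ge0 q f : (0 <= Iq q f)%E.
Proof. by apply: integral_ge0 => x _; rewrite lee_fin powR_ge0. Qed.

Lemma normr_powR2 (x : R) : `|x| `^ 2 = x ^+ 2.
Proof. by rewrite (powR_mulrn 2)// real_normK ?num_real. Qed.

(* Unlike [memLq], this does not unfold, so that side conditions are closed by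
   assumption without comparing integrals. *)
Variant inLq q f : Prop := InLq of memLq q f.

Lemma inLqE q f : inLq q f <-> memLq q f.
Proof. by split => [[]|]. Qed.

Lemma inLq_measurable q f : inLq q f -> measurable_fun D f.
Proof. by case=> -[]. Qed.

Lemma inLq_lty q f : inLq q f -> (Iq q f < +oo)%E.
Proof. by case=> -[]. Qed.

Lemma inLqP q f : measurable_fun D f -> (Iq q f < +oo)%E -> inLq q f.
Proof. by move=> mf fi; split; split. Qed.

Lemma integrable_inLq q f : inLq q f ->
  mu.-integrable D (fun x => (`|f x| `^ q)%:E).
Proof.
move=> [[mf fi]]; apply/integrableP; split; first exact: measurable_normr_powR.
apply: le_lt_trans fi; rewrite le_eqVlt; apply/orP; left; apply/eqP.
by apply: eq_integral => x _; rewrite gee0_abs// lee_fin powR_ge0.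
Qed.

Lemma inLq_integrable q f : measurable_fun D f ->
  mu.-integrable D (fun x => (`|f x| `^ q)%:E) -> inLq q f.
Proof.
move=> mf /integrableP[_ fi]; apply: inLqP => //; apply: le_lt_trans fi.
by rewrite le_eqVlt; apply/orP; left; apply/eqP; apply: eq_integral => x _;
  rewrite gee0_abs// lee_fin powR_ge0.
Qed.

Definition lin (k : R) f g : R -> R := fun x => k * f x + g x.

Lemma linE k f g x : lin k f g x = k * f x + g x. Proof. by []. Qed.

Lemma measurable_lin k f g : measurable_fun D f -> measurable_fun D g ->
  measurable_fun D (lin k f g).
Proof. by move=> mf mg; apply: measurable_funD => //; apply: measurable_funM. Qed.

Lemma inLq_le q f (F : R -> R) : measurable_fun D f ->
  mu.-integrable D (EFin \o F) ->
  (forall x, `|f x| `^ q <= F x) -> inLq q f.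
Proof.
move=> mf iF fF; apply: inLq_integrable => //.
apply: le_integrable iF => //; first exact: measurable_normr_powR.
move=> x _ /=; rewrite lee_fin ger0_norm ?powR_ge0//.
exact: le_trans (fF x) (ler_norm _).
Qed.

Lemma integrable_cst_I01 (k : R) : mu.-integrable D (EFin \o cst k).
Proof.
apply/integrableP; split; first by apply/measurable_EFinP; exact: measurable_cst.
have -> : (\int[mu]_(x in D) `|(EFin \o cst k) x| = `|k%:E| * mu D)%E.
  by rewrite -integral_cst.
by rewrite leb_I01 mule1 ltry.
Qed.

Lemma inLq_linear q (k : R) f g : 0 < q -> inLq q f -> inLq q g ->
  inLq q (lin k f g).
Proof.
move=> q0 Lf Lg; have mf := inLq_measurable Lf; have mg := inLq_measurable Lg.
pose F x := (2 `^ q * `|k| `^ q) * `|f x| `^ q + 2 `^ q * `|g x| `^ q.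
apply: (@inLq_le _ _ F).
- exact: measurable_lin.
- have -> : EFin \o F = (fun x => (2 `^ q * `|k| `^ q)%:E * (`|f x| `^ q)%:E)%E
      \+ (fun x => (2 `^ q)%:E * (`|g x| `^ q)%:E)%E.
    by apply/funext => x /=; rewrite -!EFinM -EFinD.
  by apply: integrableD => //; apply: integrableZl => //; exact: integrable_inLq.
(* Splitting with [l = 1/2] treats every [q > 0] at once. *)
- move=> x; rewrite linE; have l2 : 0 < (2^-1 : R) < 1 by lra.
  have := powR_split (ltW q0) l2 (normr_ge0 (k * f x)) (normr_ge0 (g x)).
  have -> : (1 - 2^-1)^-1 = 2 :> R by field.
  rewrite invrK normrM powRM// mulrA; apply: le_trans.
  apply: ge0_ler_powR; first exact: ltW.
  - by rewrite nnegrE.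
  - by rewrite nnegrE addr_ge0// mulr_ge0.
  - by rewrite -normrM ler_normD.
Qed.

Lemma inLq_bounded q f (M : R) : 0 <= q -> measurable_fun D f ->
  (forall x, `|f x| <= M) -> inLq q f.
Proof.
move=> q0 mf fM; apply: (@inLq_le _ _ (cst (M `^ q))) => //.
  exact: integrable_cst_I01.
move=> x /=; apply: ge0_ler_powR => //; rewrite nnegrE//.
exact: le_trans (normr_ge0 _) (fM x).
Qed.

Lemma integrable_sqr f : inLq 2 f -> mu.-integrable D (fun x => (f x ^+ 2)%:E).
Proof.
move=> /integrable_inLq; apply: eq_integrable => // x _.
by rewrite normr_powR2.
Qed.

Lemma integrable_mul f g : inLq 2 f -> inLq 2 g ->
  mu.-integrable D (fun x => (f x * g x)%:E).
Proof.
move=> Lf Lg.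
have /(_ measurable_I01) := @integrableD _ _ _ mu D _ _ _
  (integrable_sqr Lf) (integrable_sqr Lg).
apply: le_integrable => //.
- apply/measurable_EFinP; apply: measurable_funM.
  + exact: inLq_measurable Lf.
  + exact: inLq_measurable Lg.
- move=> x _ /=; rewrite lee_fin normrM.
  rewrite (ger0_norm (addr_ge0 (sqr_ge0 _) (sqr_ge0 _))).
  rewrite -[f x ^+ 2]real_normK ?num_real// -[g x ^+ 2]real_normK ?num_real//.
  have := sqr_ge0 (`|f x| - `|g x|); have := mulr_ge0 (normr_ge0 (f x)) (normr_ge0 (g x)).
  nra.
Qed.

Lemma ipE f g : inLq 2 f -> inLq 2 g -> ip f g = (ipr f g)%:E.
Proof.
move=> Lf Lg; rewrite /ipr fineK//.
by apply: integrable_fin_num => //; exact: integrable_mul.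
Qed.

Lemma iprC f g : ipr f g = ipr g f.
Proof.
by rewrite /ipr /ip; congr fine; apply: eq_integral => x _; rewrite mulrC.
Qed.

Lemma ipr_linear (k : R) f g h : inLq 2 f -> inLq 2 g -> inLq 2 h ->
  ipr (lin k f g) h = k * ipr f h + ipr g h.
Proof.
move=> Lf Lg Lh; apply: EFin_inj; rewrite EFinD EFinM -!ipE//; last first.
  exact: inLq_linear.
rewrite /ip -integralZl//; last exact: integrable_mul.
rewrite -integralD//=; last 2 first.
- by apply: integrableZl => //; exact: integrable_mul.
- exact: integrable_mul.
by apply: eq_integral => x _; rewrite linE -EFinM -EFinD; congr (_%:E); ring.
Qed.

Lemma ipr_linearr (k : R) f g h : inLq 2 f -> inLq 2 g -> inLq 2 h ->
  ipr h (lin k f g) = k * ipr h f + ipr h g.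
Proof. by move=> *; rewrite iprC ipr_linear// !(iprC h). Qed.

Lemma ipr_aeq f g h : inLq 2 f -> inLq 2 g -> inLq 2 h -> aeq f g ->
  ipr f h = ipr g h.
Proof.
move=> Lf Lg Lh fg; rewrite /ipr /ip; congr fine.
apply: ae_eq_integral => //.
- exact: measurable_int (integrable_mul Lf Lh).
- exact: measurable_int (integrable_mul Lg Lh).
- by apply: ae_lebS fg => x fg Dx /=; rewrite fg.
Qed.

Lemma Iq2E f : inLq 2 f -> Iq 2 f = (ipr f f)%:E.
Proof.
move=> Lf; rewrite -ipE// /Iq /ip; apply: eq_integral => x _.
by rewrite normr_powR2 expr2.
Qed.

Lemma ipr_ge0 f : 0 <= ipr f f.
Proof.
rewrite /ipr fine_ge0//; apply: integral_ge0 => x _.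
by rewrite lee_fin -expr2 sqr_ge0.
Qed.

Lemma ipr_Cauchy f g : inLq 2 f -> inLq 2 g ->
  ipr f g ^+ 2 <= ipr f f * ipr g g.
Proof.
move=> Lf Lg; have LZ k := inLq_linear k (ltr0n R 2) Lf Lg.
have h k : 0 <= k ^+ 2 * ipr f f + 2 * k * ipr f g + ipr g g.
  have := ipr_ge0 (lin k f g).
  by rewrite ipr_linear// !ipr_linearr// (iprC g f); lra.
have [f0|f0] := eqVneq (ipr f f) 0.
  rewrite f0 mul0r; have [->|g0] := eqVneq (ipr f g) 0; first by rewrite expr0n.
  (* The form is now affine in [k], and this [k] gives it the value [-1]. *)
  have := h (- (ipr g g + 1) / (2 * ipr f g)); rewrite f0 mulr0 add0r.
  have -> : 2 * (- (ipr g g + 1) / (2 * ipr f g)) * ipr f g = - (ipr g g + 1).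
    by field.
  lra.
have fp : 0 < ipr f f by rewrite lt0r f0 ipr_ge0.
have := h (- ipr f g / ipr f f).
have -> : (- ipr f g / ipr f f) ^+ 2 * ipr f f
   + 2 * (- ipr f g / ipr f f) * ipr f g + ipr g g =
   (ipr f f * ipr g g - ipr f g ^+ 2) / ipr f f by field.
by rewrite pmulr_lge0 ?invr_gt0// subr_ge0.
Qed.

Lemma ipr_eq0 f : inLq 2 f -> ipr f f = 0 -> aeq f (fun=> 0).
Proof.
move=> Lf f0; have mf := inLq_measurable Lf.
have : (\int[mu]_(x in D) `|(f x * f x)%:E| = 0)%E.
  rewrite -[RHS]/(0%:E) -f0 -ipE//; apply: eq_integral => x _.
  by rewrite gee0_abs// lee_fin -expr2 sqr_ge0.
move=> /ae_eq_integral_abs => /(_ measurable_I01).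
move=> /(_ (measurable_int _ (integrable_mul Lf Lf))).
apply: ae_lebS => x h Dx; have /= [] := h Dx.
by move=> /eqP; rewrite mulf_eq0 orbb => /eqP.
Qed.

Lemma aeq_refl f : aeq f f.
Proof. by rewrite /aeq /leb; apply: nearW. Qed.

Lemma aeq_sym f g : aeq f g -> aeq g f.
Proof. by apply: ae_lebS => x h Dx; rewrite h. Qed.

(** The comparison of [L_2] and [L_p] norms on a probability space, obtained by integrating a
    pointwise Young inequality at scale [B]. The constants [k] and [m] are such that
    [k B^p + m = B^2]. *)
Lemma inLq_Young p f (B : R) : 2 < p -> 0 < B -> inLq p f ->
  inLq 2 f /\ ((Iq p f <= (B `^ p)%:E)%E -> ipr f f <= B ^+ 2).
Proof.
move=> p2 B0 Lf; have mf := inLq_measurable Lf.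
pose k := 2 / p / B `^ (p - 2); pose m := (1 - 2 / p) * B ^+ 2.
have Bp : 0 < B `^ (p - 2) by exact: powR_gt0.
have p0 : 0 < p by lra.
have k0 : 0 <= k by rewrite !divr_ge0 ?ltW.
have Bpp : B `^ p = B `^ (p - 2) * B ^+ 2.
  rewrite -powR_mulrn ?(ltW B0)// -powRD; first by congr (_ `^ _); ring.
  by apply/implyP => _; rewrite gt_eqF.
have young x : `|f x| `^ 2 <= k * `|f x| `^ p + m.
  have u0 : 0 <= `|f x| / B by rewrite divr_ge0// ltW.
  have := @conjugate_powR R ((`|f x| / B) `^ 2) 1 (p / 2) (p / (p - 2))
    (powR_ge0 _ _) ler01.
  rewrite !divr_gt0//; last by lra.
  have -> : (p / 2)^-1 + (p / (p - 2))^-1 = 1 by field; lra.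
  move=> /(_ isT isT erefl); rewrite mulr1 powR1 -powRrM.
  have -> : 2 * (p / 2) = p by field.
  move=> /(ler_wpM2r (sqr_ge0 B)).
  rewrite -(powR_mulrn _ (ltW B0)) -powRM ?(ltW B0)// divfK ?gt_eqF//.
  move=> /le_trans; apply; rewrite mulrDl; apply: lerD.
    have -> : `|f x| `^ p = (`|f x| / B) `^ p * B `^ p.
      by rewrite -powRM ?(ltW B0)// divfK ?gt_eqF.
    rewrite /k Bpp powR_mulrn ?(ltW B0)// le_eqVlt; apply/orP; left; apply/eqP.
    by field; rewrite !gt_eqF.
  rewrite /m powR_mulrn ?(ltW B0)// le_eqVlt; apply/orP; left; apply/eqP.
  by field; rewrite gt_eqF//; lra.
have iF : mu.-integrable D (EFin \o (fun x => k * `|f x| `^ p + m)).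
  have -> : EFin \o (fun x => k * `|f x| `^ p + m) =
      ((fun x => k%:E * (`|f x| `^ p)%:E) \+ (EFin \o cst m))%E.
    by apply/funext => x /=; rewrite -EFinM -EFinD.
  apply: integrableD => //; last exact: integrable_cst_I01.
  by apply: integrableZl => //; exact: integrable_inLq.
have Lf2 : inLq 2 f by apply: (inLq_le mf iF).
split => // fB; rewrite -lee_fin -Iq2E//.
apply: (@le_trans _ _ (k%:E * Iq p f + m%:E)%E); last first.
  apply: (@le_trans _ _ (k%:E * (B `^ p)%:E + m%:E)%E).
    by rewrite leeD2r// lee_wpmul2l// lee_fin.
  rewrite -EFinM -EFinD lee_fin /k /m Bpp le_eqVlt; apply/orP; left; apply/eqP.
  by field; rewrite !gt_eqF.
have -> : (k%:E * Iq p f + m%:E =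
    \int[mu]_(x in D) (k * `|f x| `^ p + m)%:E)%E.
  rewrite /Iq -integralZl//; last exact: integrable_inLq.
  rewrite (_ : m%:E = \int[mu]_(x in D) (cst m%:E x))%E; last first.
    have -> : (\int[mu]_(x in D) cst m%:E x = m%:E * mu D)%E by rewrite -integral_cst.
    by rewrite leb_I01 mule1.
  rewrite -integralD//; last 2 first.
  - by apply: integrableZl => //; exact: integrable_inLq.
  - exact: integrable_cst_I01.
apply: le_integral => //; first exact: integrable_inLq.
by move=> x _; rewrite lee_fin.
Qed.

End Lq_unit_interval.

(** * Fatou's lemma for [q]-th powers *)

Section Fatou_Lq.
Variable R : realType.
Local Notation D := (I01 R).
Local Notation mu := (leb R).
Local Hint Extern 0 (measurable _) => exact: measurable_I01 : core.

Lemma le_limn_einf (u v : (\bar R) ^nat) : (forall k, (u k <= v k)%E) ->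
  (limn_einf u <= limn_einf v)%E.
Proof.
move=> uv; rewrite !limn_einf_lim.
apply: lee_lim; [exact: is_cvg_einfs|exact: is_cvg_einfs|].
apply: nearW => n; apply: le_ereal_inf_tmp => _ [k /= nk <-].
by apply: le_trans (uv k); apply: ereal_inf_lbound; exists k.
Qed.

Lemma limn_einf_EFin (u : R ^nat) (l : R) : u @ \oo --> l ->
  limn_einf (fun k => (u k)%:E) = l%:E.
Proof.
move=> ul; have ulE : (u k)%:E @[k --> \oo] --> l%:E.
  by apply: cvg_EFin => //; exact: nearW.
by have [-> _] := cvg_limn_einf_sup ulE.
Qed.

Lemma limn_esup_EFin (u : R ^nat) (l : R) : u @ \oo --> l ->
  limn_esup (fun k => (u k)%:E) = l%:E.
Proof.
move=> ul; have ulE : (u k)%:E @[k --> \oo] --> l%:E.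
  by apply: cvg_EFin => //; exact: nearW.
by have [_ ->] := cvg_limn_einf_sup ulE.
Qed.

(* By convexity [|u_k|^q] lies above its tangent at [|l|], which tends to [|l|^q]. *)
Lemma normR_powR_limn_einf q (u : R ^nat) (l : R) : 1 <= q -> u @ \oo --> l ->
  ((`|l| `^ q)%:E <= limn_einf (fun k => (`|u k| `^ q)%:E))%E.
Proof.
move=> q1 ul; have [l0|l0] := eqVneq l 0.
  rewrite l0 normr0 powR0; last by apply/eqP; lra.
  rewrite -(limn_einf_EFin (cvg_cst 0)); apply: le_limn_einf => k.
  by rewrite lee_fin powR_ge0.
pose v k := `|l| `^ q + q * (`|l| `^ (q - 1)) * (`|u k| - `|l|).
have vl : v @ \oo --> `|l| `^ q.
  rewrite -[X in _ --> X]addr0; apply: cvgD; first exact: cvg_cst.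
  rewrite -[X in _ --> X](mulr0 (q * (`|l| `^ (q - 1)))).
  apply: cvgM; first exact: cvg_cst.
  by rewrite -(subrr `|l|); apply: cvgB; [exact: cvg_norm|exact: cvg_cst].
rewrite -(limn_einf_EFin vl); apply: le_limn_einf => k.
by rewrite lee_fin powR_tangent// normr_gt0.
Qed.

(** Carries bounds on partial sums to their limit. The bound [m k] may vary with [k]: this serves
    for the [L_2] distance from the limit to a fixed partial sum. *)
Lemma Fatou_Iq q (u : nat -> R -> R) (F : R -> R) (m : R ^nat) (M : R) : 1 <= q ->
  (forall k, measurable_fun D (u k)) -> measurable_fun D F ->
  (\forall x \ae mu, D x -> u k x @[k --> \oo] --> F x) ->
  (forall k, (Iq q (u k) <= (m k)%:E)%E) -> m @ \oo --> M ->
  (Iq q F <= M%:E)%E.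
Proof.
move=> q1 mu_ mF uF um mM.
have mP k := measurable_normr_powR q (mu_ k).
apply: (@le_trans _ _
  (\int[mu]_(x in D) limn_einf (fun k => (`|u k x| `^ q)%:E))%E).
  apply: ae_ge0_le_integral => //.
  - exact: measurable_normr_powR.
  - move=> x Dx; rewrite -[X in (X <= _)%E](limn_einf_EFin (cvg_cst 0)).
    by apply: le_limn_einf => k; rewrite lee_fin powR_ge0.
  - rewrite /limn_einf.
    apply: (measurableT_comp (@oppe_measurable R setT)).
    apply: (@measurable_fun_limn_esup _ _ _ _ (fun k x => - (`|u k x| `^ q)%:E)%E) => k.
    exact: (measurableT_comp (@oppe_measurable R setT) (mP k)).
  - by apply: ae_lebS uF => x uF Dx; apply: normR_powR_limn_einf => //; exact: uF.
rewrite -(limn_einf_EFin mM).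
apply: (@le_trans _ _ (limn_einf (fun k => Iq q (u k)))); last exact: le_limn_einf.
by apply: fatou => // k x _; rewrite lee_fin powR_ge0.
Qed.

End Fatou_Lq.

(** * The orthogonal system on [[0,1]] and its partial sums *)

Section ternary_system.
Variables (R : realType) (a : R ^nat).
Hypothesis a01 : forall n, 0 < a n <= 1.
Implicit Types (c : R ^nat) (f g h F : R -> R) (N M n m : nat).
Local Notation D := (I01 R).
Local Hint Extern 0 (measurable _) => exact: measurable_I01 : core.

Let a_ge0_le1 n : 0 <= a n <= 1.
Proof. by have /andP[a0 ->] := a01 n; rewrite ltW. Qed.

Let a_gt0 n : 0 < a n. Proof. by have /andP[] := a01 n. Qed.

Definition tern n : R -> R := ternary n a 0 1.
Definition tern_sum N c : R -> R := ternary_sum N c a 0 1.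
Definition sqsum c N : R := \sum_(i < N) a i * c i ^+ 2.

Lemma measurable_tern_sum N c : measurable_fun D (tern_sum N c).
Proof. exact: measurable_funTS (measurable_ternary_sum _ _ _ _ _). Qed.

Lemma Iq_tern_sum q N c :
  Iq q (tern_sum N c) = (walk N c a (fun s => `|s| `^ q) 0)%:E.
Proof.
have mphi : measurable_fun [set: R] (fun s : R => `|s| `^ q).
  apply: (measurableT_comp (measurable_powR q)); exact: normr_measurable.
have := @integral_ternary_sum R N c a (fun s => `|s| `^ q) 0 0 1
  a_ge0_le1 ler01 mphi (fun s => powR_ge0 _ _).
(* The construction lives on the half-open interval; the end point 1 is negligible. *)
rewrite mul1r => <-; rewrite add0r /leb integral_itv_bndo_bndc.
  by apply: eq_integral => x _; rewrite add0r.
apply: measurable_funTS; apply/measurable_EFinP; apply: (measurableT_comp mphi).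
by apply: measurable_funD => //; exact: measurable_ternary_sum.
Qed.

Lemma inLq_tern_sum q N c : inLq q (tern_sum N c).
Proof.
apply: inLqP; first exact: measurable_tern_sum.
by rewrite Iq_tern_sum ltry.
Qed.

Lemma inLq_tern q n : 0 <= q -> inLq q (tern n).
Proof.
move=> q0; apply: (@inLq_bounded _ _ _ 1) => //.
  exact: measurable_funTS (measurable_ternary _ _ _ _).
by move=> x; exact: normr_ternary_le1.
Qed.

Lemma tern_sumS N c : tern_sum N.+1 c = lin (c N) (tern N) (tern_sum N c).
Proof. by apply/funext => x; rewrite linE /tern_sum /ternary_sum big_ord_recr /= addrC. Qed.

Lemma tern_sum_delta n N : (n < N)%N -> tern_sum N (fun i => (i == n)%:R) = tern n.
Proof.
move=> nN; apply/funext => x; rewrite /tern_sum /ternary_sum.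
rewrite (bigD1 (Ordinal nN)) //= eqxx mul1r big1 ?addr0// => i.
by rewrite -val_eqE /= => /negbTE ->; rewrite mul0r.
Qed.

Let L2S N c : inLq 2 (tern_sum N c). Proof. exact: inLq_tern_sum. Qed.
Let L2t n : inLq 2 (tern n). Proof. exact: inLq_tern. Qed.
Local Hint Resolve L2S L2t : core.

Lemma ipr_tern_sum_sqr N c : ipr (tern_sum N c) (tern_sum N c) = sqsum c N.
Proof.
apply: EFin_inj; rewrite -Iq2E// Iq_tern_sum; congr (_%:E).
transitivity (walk N c a (fun s => s ^+ 2) 0); last by rewrite walk_sqr expr0n add0r.
by congr (walk _ _ _ _ _); apply/funext => s; exact: normr_powR2.
Qed.

(* Comparing the squared norms for the coefficients [1] and [-1] of the last function. *)
Lemma ipr_tern_tern_sum N c :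
  ipr (tern N) (tern N) = a N /\ ipr (tern N) (tern_sum N c) = 0.
Proof.
pose d (x : R) : R ^nat := fun i => if i == N then x else c i.
have dN x : d x N = x by rewrite /d eqxx.
have dE x : tern_sum N (d x) = tern_sum N c.
  apply/funext => t; rewrite /tern_sum /ternary_sum; apply: eq_bigr => i _.
  by rewrite /d ltn_eqF.
have sE x : sqsum (d x) N.+1 = sqsum c N + a N * x ^+ 2.
  rewrite /sqsum big_ord_recr /= dN; congr (_ + _); apply: eq_bigr => i _.
  by rewrite /d ltn_eqF.
have h x : x ^+ 2 * ipr (tern N) (tern N) + 2 * x * ipr (tern N) (tern_sum N c) =
    a N * x ^+ 2.
  have := ipr_tern_sum_sqr N.+1 (d x).
  rewrite sE tern_sumS dN dE ipr_linear//; last exact: inLq_linear.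
  rewrite !ipr_linearr// ipr_tern_sum_sqr (iprC (tern_sum N c)); lra.
have := h 1; have := h (- 1); rewrite sqrrN expr1n; lra.
Qed.

Lemma ipr_tern n m : ipr (tern n) (tern m) = if n == m then a n else 0.
Proof.
have [<-|] := eqVneq n m; first by have [] := ipr_tern_tern_sum n (fun=> 0).
rewrite neq_ltn => /orP[nm|mn].
  have [_] := ipr_tern_tern_sum m (fun i => (i == n)%:R).
  by rewrite tern_sum_delta// iprC.
have [_] := ipr_tern_tern_sum n (fun i => (i == m)%:R).
by rewrite tern_sum_delta.
Qed.

Lemma ipr_tern_sum N c g : inLq 2 g ->
  ipr (tern_sum N c) g = \sum_(i < N) c i * ipr (tern i) g.
Proof.
move=> Lg; elim: N => [|N IHN].
  rewrite big_ord0 /ipr /ip (_ : (fun x => _) = cst 0%E); last first.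
    by apply/funext => x; rewrite /tern_sum /ternary_sum big_ord0 mul0r.
  by rewrite integral0.
by rewrite tern_sumS ipr_linear// big_ord_recr /= addrC IHN.
Qed.

Lemma ipr_tern_sum_tern N c n :
  ipr (tern_sum N c) (tern n) = if (n < N)%N then c n * a n else 0.
Proof.
rewrite ipr_tern_sum//; case: ifPn => nN.
  rewrite (bigD1 (Ordinal nN)) //= ipr_tern eqxx big1 ?addr0// => i.
  by rewrite -val_eqE /= ipr_tern => /negbTE ->; rewrite mulr0.
rewrite big1// => i _; rewrite ipr_tern ltn_eqF ?mulr0//.
by rewrite (leq_trans (ltn_ord i))// leqNgt.
Qed.

Lemma ipr_tern_sum2 M N c : (M <= N)%N ->
  ipr (tern_sum M c) (tern_sum N c) = sqsum c M.
Proof.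
move=> MN; rewrite ipr_tern_sum//; apply: eq_bigr => i _.
by rewrite iprC ipr_tern_sum_tern (leq_trans (ltn_ord i) MN); ring.
Qed.

Definition tdiff f g : R -> R := lin (-1) g f.

Lemma inLq_tdiff q f g : 0 < q -> inLq q f -> inLq q g -> inLq q (tdiff f g).
Proof. by move=> q0 Lf Lg; exact: inLq_linear. Qed.

Lemma tdiffE f g x : tdiff f g x = f x - g x.
Proof. by rewrite /tdiff linE mulN1r addrC. Qed.

Lemma ipr_tdiffl f g h : inLq 2 f -> inLq 2 g -> inLq 2 h ->
  ipr (tdiff f g) h = ipr f h - ipr g h.
Proof. by move=> *; rewrite ipr_linear// mulN1r addrC. Qed.

Lemma ipr_tdiff f g : inLq 2 f -> inLq 2 g ->
  ipr (tdiff f g) (tdiff f g) = ipr f f - 2 * ipr f g + ipr g g.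
Proof.
move=> Lf Lg; rewrite ipr_linear//; last exact: inLq_linear.
by rewrite !ipr_linearr// (iprC g f); ring.
Qed.

Lemma sqsum_nondecreasing c : {homo sqsum c : n m / (n <= m)%N >-> n <= m}.
Proof.
move=> n m; elim: m => [|m IHm]; first by rewrite leqn0 => /eqP ->.
rewrite leq_eqVlt => /predU1P[->//|]; rewrite ltnS => /IHm /le_trans; apply.
by rewrite /sqsum big_ord_recr /= lerDl mulr_ge0 ?sqr_ge0// ltW.
Qed.

Lemma ipr_tdiff_tern_sum M N c :
  ipr (tdiff (tern_sum M c) (tern_sum N c)) (tdiff (tern_sum M c) (tern_sum N c)) =
  `|sqsum c M - sqsum c N|.
Proof.
rewrite ipr_tdiff// !ipr_tern_sum_sqr.
have [MN|/ltnW NM] := leqP M N.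
  rewrite ipr_tern_sum2// ler0_norm ?subr_le0; first by ring.
  exact: sqsum_nondecreasing.
rewrite (iprC (tern_sum M c)) ipr_tern_sum2// ger0_norm ?subr_ge0; first by ring.
exact: sqsum_nondecreasing.
Qed.

End ternary_system.

(** * Infinite sums, coefficients and their estimates *)

Section synthesis.
Variables (R : realType) (a : R ^nat).
Hypothesis a01 : forall n, 0 < a n <= 1.
Implicit Types (c : R ^nat) (f g F H : R -> R) (N M n m : nat) (p B : R).
Local Notation D := (I01 R).
Local Notation mu := (leb R).
Local Hint Extern 0 (measurable _) => exact: measurable_I01 : core.

Local Notation tern := (tern a).
Local Notation tern_sum := (tern_sum a).
Local Notation sqsum := (sqsum a).

Let a_gt0 n : 0 < a n. Proof. by have /andP[] := a01 n. Qed.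
Let L2S N c : inLq 2 (tern_sum N c). Proof. exact: inLq_tern_sum. Qed.
Let L2t n : inLq 2 (tern n). Proof. exact: inLq_tern. Qed.
Local Hint Extern 0 (inLq _ (tern_sum _ _)) => exact: L2S : core.
Local Hint Extern 0 (inLq _ (tern _)) => exact: L2t : core.

(** [F] represents the sum of the series with coefficients [c]. The convergence in [L_2] gives inner
    products and coefficients; the convergence almost everywhere along a subsequence is what Fatou's
    lemma takes. *)
Definition is_syn c F := [/\ inLq 2 F,
  ipr (tdiff F (tern_sum N c)) (tdiff F (tern_sum N c)) @[N --> \oo] --> 0 &
  exists Nk : nat -> nat,
    \forall x \ae mu, D x -> tern_sum (Nk k) c x @[k --> \oo] --> F x].

Lemma integral_normr_le f (e : R) : inLq 2 f -> 0 <= e -> ipr f f <= e ^+ 2 ->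
  (\int[mu]_(x in D) `|f x|%:E <= e%:E)%E.
Proof.
move=> Lf e0 fe; have mf := inLq_measurable Lf.
pose g x := `|f x|.
have Lg : inLq 2 g.
  apply: inLqP; first exact: (measurableT_comp (@normr_measurable R setT) mf).
  have := inLq_lty Lf; apply: le_lt_trans; rewrite le_eqVlt; apply/orP; left; apply/eqP.
  by apply: eq_integral => x _; rewrite /g normr_id.
have gE : ipr g g = ipr f f.
  rewrite /ipr /ip; congr fine; apply: eq_integral => x _.
  by rewrite /g -!expr2 real_normK ?num_real.
have L1 : inLq 2 (fun=> 1 : R).
  apply: (@inLq_bounded _ _ _ 1) => // x; by rewrite normr1.
have one : ipr (fun=> 1) (fun=> 1) = 1 :> R.
  rewrite /ipr /ip.
  have -> : (\int[mu]_(x in D) (1 * 1)%:E = 1%:E * mu D)%E.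
    by rewrite -integral_cst//; apply: eq_integral => x _; rewrite mulr1.
  by rewrite leb_I01 mule1.
have -> : (\int[mu]_(x in D) `|f x|%:E = (ipr g (fun=> 1))%:E)%E.
  by rewrite -ipE//; apply: eq_integral => x _; rewrite mulr1.
rewrite lee_fin; have := ipr_Cauchy Lg L1; rewrite gE one mulr1.
move=> /le_trans/(_ fe); have [i0|/ltW i0 _] := leP 0 (ipr g (fun=> 1)).
  by rewrite ler_sqr ?nnegrE.
exact: le_trans i0 e0.
Qed.

Lemma is_cvg_of_summable (u : R ^nat) :
  (\sum_(0 <= k <oo) (`|u k.+1 - u k|)%:E)%E \is a fin_num -> cvgn u.
Proof.
move=> ufin.
have : cvgn [normed series (telescope u)].
  apply: nondecreasing_is_cvgn.
    by apply: nondecreasing_series => n _ _; exact: normr_ge0.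
  exists (fine (\sum_(0 <= k <oo) (`|u k.+1 - u k|)%:E)%E) => _ [n _ <-].
  rewrite -lee_fin fineK// /series /= -sumEFin.
  by apply: nneseries_lim_ge => k _ _; rewrite lee_fin.
move=> /normed_cvg; rewrite telescopeK => h.
have -> : u = (fun n => u n - u 0%N) \+ cst (u 0%N).
  by apply/funext => n /=; rewrite subrK.
by apply: is_cvgD => //; exact: is_cvg_cst.
Qed.

(** The Riesz-Fischer argument: along a subsequence the increments have [L_2] norms, hence [L_1]
    norms, at most [2^-(k+1)], so they are absolutely summable almost everywhere. *)
Lemma is_syn_exists c B : (forall N, sqsum c N <= B) -> exists F, is_syn c F.
Proof.
move=> sB.
have ndc := sqsum_nondecreasing a01 c.
have cs : cvgn (sqsum c).
  by apply: nondecreasing_is_cvgn => //; exists B => _ [n _ <-].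
pose L := limn (sqsum c).
have sL N : sqsum c N <= L by exact: nondecreasing_cvgn_le.
pose e k : R := 1 / (2 ^ k.+1)%:R.
have e0 k : 0 < e k by rewrite divr_gt0// ltr0n expn_gt0.
have /choice[Nk NkP] : forall k, exists N, (k <= N)%N /\ L - sqsum c N <= e k ^+ 2.
  move=> k; have := @cvgrPdist_le _ _ _ \oo _ (sqsum c) L.
  move=> [/(_ cs) /(_ (e k ^+ 2) (exprn_gt0 _ (e0 k))) h _].
  have [N _ NP] := h; exists (maxn k N); rewrite leq_maxl; split => //.
  by apply: le_trans (ler_norm _) _; apply: NP; rewrite /= leq_maxr.
pose u k := tern_sum (Nk k) c.
have sNk : sqsum c (Nk k) @[k --> \oo] --> L.
  apply: (@squeeze_cvgr _ _ _ _ (sqsum c) (cst L)) => //; last exact: cvg_cst.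
  by apply: nearW => k; rewrite sL andbT; apply: ndc; case: (NkP k).
have eS k : e k.+1 <= e k.
  rewrite /e !div1r lef_pV2 ?posrE ?ltr0n ?expn_gt0// ler_nat.
  by rewrite leq_exp2l.
have vle k : ipr (tdiff (u k.+1) (u k)) (tdiff (u k.+1) (u k)) <= e k ^+ 2.
  rewrite ipr_tdiff_tern_sum//; have [_ h1] := NkP k; have [_ h2] := NkP k.+1.
  have := sL (Nk k); have := sL (Nk k.+1).
  have : e k.+1 ^+ 2 <= e k ^+ 2 by rewrite ler_sqr ?nnegrE ?eS ?(ltW (e0 _)).
  by move=> *; rewrite ler_norml; apply/andP; split; lra.
have Lv k : inLq 2 (tdiff (u k.+1) (u k)) by exact: inLq_tdiff (ltr0n R 2) (L2S _ _) (L2S _ _).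
have mnv k : measurable_fun D (fun x => (`|u k.+1 x - u k x|)%:E).
  apply/measurable_EFinP; apply: (measurableT_comp (@normr_measurable R setT)).
  by apply: measurable_funB; exact: measurable_tern_sum.
have mG : measurable_fun D
    (fun x => \sum_(0 <= k <oo) (`|u k.+1 x - u k x|)%:E)%E.
  by apply: ge0_emeasurable_sum => // k x _ _; rewrite lee_fin.
have iG : (\int[mu]_(x in D) (\sum_(0 <= k <oo) (`|u k.+1 x - u k x|)%:E) <= 1%:E)%E.
  rewrite integral_nneseries//.
  apply: le_trans (@epsilon_trick0 R 1 xpredT ler01).
  apply: lee_nneseries => [k _ _|k _]; first exact: integral_ge0.
  have := integral_normr_le (Lv k) (ltW (e0 k)) (vle k).
  apply: le_trans; rewrite le_eqVlt; apply/orP; left; apply/eqP.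
  by apply: eq_integral => x _; rewrite tdiffE.
have ucvg : \forall x \ae mu, D x -> cvgn (fun k => u k x).
  have : mu.-integrable D (fun x => \sum_(0 <= k <oo) (`|u k.+1 x - u k x|)%:E)%E.
    apply/integrableP; split => //; apply: le_lt_trans (ltry 1).
    apply: le_trans iG; rewrite le_eqVlt; apply/orP; left; apply/eqP.
    by apply: eq_integral => x _; rewrite gee0_abs// nneseries_ge0.
  move=> iG1; apply: ae_lebS (@integrable_ae _ _ _ mu D (@measurable_I01 R) _ iG1) => x h Dx.
  exact/is_cvg_of_summable/h.
(* The upper limit is measurable everywhere and equals the limit wherever the latter exists. *)
pose F x := fine (limn_esup (fun k => (u k x)%:E)).
have mu_ k : measurable_fun D (u k) by exact: measurable_tern_sum.
have mF : measurable_fun D F.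
  apply: (measurableT_comp (fine_measurable measurableT)).
  by apply: measurable_fun_limn_esup => k; apply/measurable_EFinP.
have uF : \forall x \ae mu, D x -> u k x @[k --> \oo] --> F x.
  apply: ae_lebS ucvg => x h Dx; have {}h := h Dx.
  by rewrite /F (limn_esup_EFin h).
have LF : inLq 2 F.
  apply: inLqP => //; apply: le_lt_trans (ltry L).
  apply: (Fatou_Iq _ mu_ mF uF _ sNk) => [|k]; first by rewrite ler1n.
  by rewrite Iq2E /u ?ipr_tern_sum_sqr.
exists F; split => //; last by exists Nk.
(* Fatou's lemma along the subsequence, with [N] fixed, bounds the tail by the remainder of the
   convergent series of squares. *)
have dF N : ipr (tdiff F (tern_sum N c)) (tdiff F (tern_sum N c)) <= L - sqsum c N.
  have LFS : inLq 2 (tdiff F (tern_sum N c)) by exact: inLq_tdiff.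
  rewrite -lee_fin -Iq2E//.
  have : `|sqsum c (Nk k) - sqsum c N| @[k --> \oo] --> L - sqsum c N.
    have -> : L - sqsum c N = `|L - sqsum c N| by rewrite ger0_norm// subr_ge0.
    by apply: cvg_norm; apply: cvgB => //; exact: cvg_cst.
  apply: (@Fatou_Iq _ 2 (fun k => tdiff (u k) (tern_sum N c))) => //.
  - by rewrite ler1n.
  - by move=> k; exact: inLq_measurable (inLq_tdiff (ltr0n R 2) (L2S (Nk k) c) (L2S N c)).
  - exact: inLq_measurable LFS.
  - apply: ae_lebS uF => x uF Dx; rewrite tdiffE.
    under eq_cvg do rewrite tdiffE.
    by apply: cvgB; [exact: uF|exact: cvg_cst].
  - move=> k; have Lk := inLq_tdiff (ltr0n R 2) (L2S (Nk k) c) (L2S N c).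
    by rewrite (Iq2E Lk) (ipr_tdiff_tern_sum a01).
apply: (@squeeze_cvgr _ _ _ _ (cst 0) (fun N => L - sqsum c N)).
- by apply: nearW => N; rewrite ipr_ge0 dF.
- exact: cvg_cst.
- by rewrite -(subrr L); apply: cvgB; [exact: cvg_cst|exact: cs].
Qed.

Lemma is_syn_ipr c F g : is_syn c F -> inLq 2 g ->
  ipr (tern_sum N c) g @[N --> \oo] --> ipr F g.
Proof.
move=> [LF dF _] Lg; apply/cvgrPdist_le => eps eps0.
have G0 := ipr_ge0 g.
have d0 : 0 < eps ^+ 2 / (ipr g g + 1) by rewrite divr_gt0 ?exprn_gt0//; lra.
move/cvgrPdist_le : dF => /(_ _ d0); apply: filterS => N.
rewrite sub0r normrN ger0_norm ?ipr_ge0// => dN.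
have LD : inLq 2 (tdiff F (tern_sum N c)) by exact: inLq_tdiff.
have := ipr_Cauchy LD Lg; rewrite ipr_tdiffl//.
move=> h; rewrite -ler_sqr ?nnegrE ?(ltW eps0)// real_normK ?num_real//.
apply: (le_trans h); apply: (le_trans (ler_wpM2r G0 dN)).
rewrite mulrAC ler_pdivrMr; last by lra.
by apply: ler_wpM2l; [exact: sqr_ge0|lra].
Qed.

Lemma is_syn_orth c F H : is_syn c F -> inLq 2 H ->
  (forall n, ipr H (tern n) = 0) -> ipr F H = 0.
Proof.
move=> Fc LH H0; have := is_syn_ipr Fc LH.
have -> : (fun N => ipr (tern_sum N c) H) = cst 0.
  apply/funext => N; rewrite ipr_tern_sum// big1// => i _.
  by rewrite iprC H0 mulr0.
by move=> /cvg_lim <-//; rewrite lim_cst.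
Qed.

Definition coef f n := ipr f (tern n) / a n.

Lemma ipr_coef f n : ipr f (tern n) = coef f n * a n.
Proof. by rewrite /coef divfK// gt_eqF. Qed.

Lemma coef_syn c F : is_syn c F -> coef F = c.
Proof.
move=> Fc; apply/funext => n; have := is_syn_ipr Fc (L2t n).
move=> /cvg_lim => h; rewrite /coef -h//.
rewrite (_ : limn _ = c n * a n) ?mulfK ?gt_eqF//.
apply: cvg_lim => //; apply: cvg_near_cst; exists n.+1 => // N /= nN.
by rewrite ipr_tern_sum_tern// nN.
Qed.

Lemma ipr_tern_sum_coef f N : inLq 2 f ->
  ipr (tern_sum N (coef f)) f = sqsum (coef f) N.
Proof.
move=> Lf; rewrite ipr_tern_sum//; apply: eq_bigr => i _.
by rewrite iprC ipr_coef; ring.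
Qed.

Lemma Bessel f N : inLq 2 f -> sqsum (coef f) N <= ipr f f.
Proof.
move=> Lf; have := ipr_ge0 (tdiff f (tern_sum N (coef f))).
rewrite ipr_tdiff// (iprC f) ipr_tern_sum_coef// ipr_tern_sum_sqr//; lra.
Qed.

(** One representative is chosen for each coefficient sequence. Functions with equal coefficients
    therefore get the very same image, and idempotence of the projection is an equality of
    functions. *)
Definition syn c : R -> R := xget (fun=> 0) [set F | is_syn c F].

Lemma synP c B : (forall N, sqsum c N <= B) -> is_syn c (syn c).
Proof. by move=> /is_syn_exists[F Fc]; exact: (xgetPex (fun=> 0) (ex_intro _ F Fc)). Qed.

Lemma syn_coefP f : inLq 2 f -> is_syn (coef f) (syn (coef f)).
Proof. by move=> Lf; apply: (@synP _ (ipr f f)) => N; exact: Bessel. Qed.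

Lemma aeq_ipr0 f g : inLq 2 f -> inLq 2 g ->
  ipr (tdiff f g) (tdiff f g) = 0 -> aeq f g.
Proof.
move=> Lf Lg h; have := ipr_eq0 (inLq_tdiff (ltr0n R 2) Lf Lg) h.
apply: ae_lebS => x fg Dx; move: (fg Dx); rewrite tdiffE => /eqP.
by rewrite subr_eq0 => /eqP.
Qed.

(* The difference of the two sides is orthogonal to every [tern n], hence to
   each of the three functions it is made of, hence to itself. *)
Lemma is_syn_linear (k : R) c d F G E :
  is_syn c F -> is_syn d G -> is_syn (fun n => k * c n + d n) E ->
  aeq E (lin k F G).
Proof.
move=> Fc Gd Ecd; have [LF _ _] := Fc; have [LG _ _] := Gd; have [LE _ _] := Ecd.
have LFG : inLq 2 (lin k F G) by exact: inLq_linear.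
apply: aeq_ipr0 => //; set H := tdiff _ _.
have LH : inLq 2 H by exact: inLq_tdiff.
have H0 n : ipr H (tern n) = 0.
  rewrite ipr_tdiffl// ipr_linear// !ipr_coef.
  by rewrite (coef_syn Fc) (coef_syn Gd) (coef_syn Ecd); ring.
have := is_syn_orth Fc LH H0; have := is_syn_orth Gd LH H0.
have := is_syn_orth Ecd LH H0 => h1 h2 h3.
by rewrite {1}/H ipr_tdiffl// ipr_linear// h1 h2 h3; ring.
Qed.

Lemma Iq_syn p c F B : 2 < p -> is_syn c F -> 0 < B ->
  (forall N, sqsum c N <= B ^+ 2) ->
  (forall N, \sum_(i < N) a i * `|c i| `^ p <= B `^ p) ->
  (Iq p F <= ((Rosenthal_cst p * B) `^ p)%:E)%E.
Proof.
move=> p2 [LF _ [Nk NkF]] B0 s2 sp.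
have a_ge0_le1 n : 0 <= a n <= 1 by have /andP[a0 ->] := a01 n; rewrite ltW.
apply: (@Fatou_Iq _ p (fun k => tern_sum (Nk k) c) F
  (fun=> (Rosenthal_cst p * B) `^ p)) => //.
- by lra.
- by move=> k; exact: measurable_tern_sum.
- exact: inLq_measurable LF.
- by move=> k; rewrite Iq_tern_sum// lee_fin; exact: walk_Rosenthal (s2 _) (sp _).
- exact: cvg_cst.
Qed.

(* Testing [f] against [\sum_i |c_i|^(p-2) c_i tern_i], whose conjugate norm is
   controlled because [tern_i] is symmetric and the conjugate exponent is at most [2]. *)
Lemma coef_powR_le p f N : 2 < p -> inLq 2 f -> inLq p f ->
  ((\sum_(i < N) a i * `|coef f i| `^ p)%:E <= Iq p f)%E.
Proof.
move=> p2 Lf Lpf; set c := coef f; set T := \sum_(i < N) _.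
have a_ge0_le1 n : 0 <= a n <= 1 by have /andP[a0 ->] := a01 n; rewrite ltW.
pose d i := c i * `|c i| `^ (p - 2); pose q := p / (p - 1).
have p0 : 0 < p by lra.
have q0 : 0 < q by rewrite divr_gt0//; lra.
have q12 : 1 <= q <= 2.
  by rewrite /q ler_pdivlMr ?ler_pdivrMr; lra.
have pq : p^-1 + q^-1 = 1 by rewrite /q; field; lra.
pose G := tern_sum N d.
have LG : inLq 2 G by exact: L2S.
have LqG : inLq q G by exact: inLq_tern_sum.
have TE : ipr f G = T.
  rewrite iprC ipr_tern_sum//; apply: eq_bigr => i _.
  by rewrite iprC ipr_coef -/c -signed_powRE// /d; ring.
have dE i : `|d i| `^ q = `|c i| `^ p.
  rewrite /d normrM (ger0_norm (powR_ge0 _ _)).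
  have -> : p - 2 = (p - 1) - 1 by ring.
  rewrite mulr_powRB1//; last by lra.
  by rewrite -powRrM; congr (_ `^ _); rewrite /q; field; lra.
have GT : (Iq q G <= T%:E)%E.
  rewrite Iq_tern_sum// lee_fin.
  have := walk_subadditive N d 0 a_ge0_le1
    (fun s t => normR_powR_subadditive s t q12).
  rewrite normr0 powR0 ?gt_eqF// add0r => /le_trans; apply.
  by rewrite le_eqVlt; apply/orP; left; apply/eqP; apply: eq_bigr => i _; rewrite dE.
have Ifin : Iq p f \is a fin_num.
  by apply: integrable_fin_num => //; exact: integrable_inLq.
(* Young's inequality under the integral of [f G]. As the integral of [|G|^q] is at most [T] itself,
   the term [T / q] is absorbed and leaves [T / p] on the left. *)
have key : (T%:E <= (p^-1)%:E * Iq p f + (q^-1)%:E * T%:E)%E.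
  apply: (@le_trans _ _ ((p^-1)%:E * Iq p f + (q^-1)%:E * Iq q G)%E); last first.
    by rewrite leeD2l// lee_wpmul2l// lee_fin invr_ge0 ltW.
  have ifp := integrable_inLq Lpf; have igq := integrable_inLq LqG.
  rewrite -TE -ipE// /Iq -!integralZl//.
  have ifp' := @integrableZl _ _ _ mu D (@measurable_I01 R) p^-1 _ ifp.
  have igq' := @integrableZl _ _ _ mu D (@measurable_I01 R) q^-1 _ igq.
  rewrite -integralD//; apply: le_integral => //.
  - exact: integrable_mul.
  - exact: integrableD.
  - move=> x _; rewrite -!EFinM -EFinD lee_fin.
    apply: (le_trans (ler_norm _)); rewrite normrM.
    rewrite ![_^-1 * _]mulrC; exact: conjugate_powR.
move: key; rewrite -(fineK Ifin) -!EFinM -EFinD !lee_fin.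
have -> : q^-1 = 1 - p^-1 by lra.
move=> key; rewrite -(@ler_pM2l _ p^-1) ?invr_gt0//; lra.
Qed.

End synthesis.

(** * Norms, their powers and series of nonnegative terms *)

Section Lqnorm.
Variable R : realType.
Implicit Types (f g : R -> R) (p q b e : R).
Local Notation D := (I01 R).

Lemma Lqnorm_le q f b : 0 < q -> 0 <= b -> (Iq q f <= (b `^ q)%:E)%E ->
  (Lqnorm q f <= b%:E)%E.
Proof.
move=> q0 b0 fb; rewrite /Lqnorm -/(Iq q f).
have := @gt0_ler_poweR R q^-1 _ _ _ _ _ fb.
rewrite poweR_EFin -powRrM mulfV ?gt_eqF// powRr1//; apply.
- by rewrite invr_ge0 ltW.
- by rewrite in_itv/= Iq_ge0 leey.
- by rewrite in_itv/= lee_fin powR_ge0 leey.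
Qed.

Lemma LqnormE q f : 0 < q -> inLq q f ->
  exists2 b, 0 <= b & Lqnorm q f = b%:E /\ Iq q f = (b `^ q)%:E.
Proof.
move=> q0 Lf; have I0 := Iq_ge0 q f.
have Ifin : Iq q f \is a fin_num by rewrite ge0_fin_numE// (inLq_lty Lf).
exists (fine (Iq q f) `^ q^-1); first exact: powR_ge0.
split; first by rewrite /Lqnorm -/(Iq q f) -{1}(fineK Ifin) poweR_EFin.
by rewrite -powRrM mulVf ?gt_eqF// powRr1 ?fine_ge0// fineK.
Qed.

Lemma Lqnorm_lt q f e : 0 < q -> measurable_fun D f -> (Lqnorm q f < e%:E)%E ->
  inLq q f /\ (Iq q f <= (e `^ q)%:E)%E.
Proof.
move=> q0 mf fe.
have Lf : inLq q f.
  apply: inLqP => //; rewrite ltNge leye_eq; apply/negP => /eqP Iy.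
  by move: fe; rewrite /Lqnorm -/(Iq q f) Iy poweRyr ?invr_neq0 ?gt_eqF//.
split => //; have [b b0 [E ->]] := LqnormE q0 Lf.
move: fe; rewrite E lte_fin lee_fin => be; apply: ge0_ler_powR; rewrite ?nnegrE//.
- exact: ltW.
- exact: le_trans b0 (ltW be).
- exact: ltW.
Qed.

Lemma Lqnorm0 q : 0 < q -> Lqnorm q (fun=> 0 : R) = 0%E.
Proof.
move=> q0; rewrite /Lqnorm (_ : (fun x => _) = cst 0%E); last first.
  by apply/funext => x; rewrite normr0 powR0 ?gt_eqF.
by rewrite integral0 poweR0r// invr_neq0// gt_eqF.
Qed.

(** Extends estimates proved for positive [B] to all [b >= 0], zero included. The choice of [d <= 1]
    gives [(b + d)^2 <= b^2 + d (2 b + 1) <= b^2 + e]. *)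
Lemma sqr_le_all (x b : R) : 0 <= b -> (forall B, b < B -> x <= B ^+ 2) -> x <= b ^+ 2.
Proof.
move=> b0 h; apply/ler_addgt0Pr => e e0.
pose d := Num.min 1 (e / (2 * b + 1)).
have b1 : 0 < 2 * b + 1 by lra.
have d0 : 0 < d by rewrite lt_min ltr01 divr_gt0.
have d1 : d <= 1 by rewrite ge_min lexx.
have de : d * (2 * b + 1) <= e by rewrite -ler_pdivlMr// ge_min lexx orbT.
apply: (le_trans (h (b + d) _)); first by lra.
nra.
Qed.

Lemma le_of_sqr_le (v u d t : R) :
  v = u -> u ^+ 2 <= v * d -> 0 <= v -> 0 <= d -> d <= t -> v <= t.
Proof.
move=> <- vd v0 d0 dt; apply: le_trans dt; move: vd; rewrite expr2.
have [v1|v1 _] := ltP 0 v; first by rewrite ler_pM2l.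
exact: le_trans v1 d0.
Qed.

Lemma ipr_le_Iq p f b : 2 < p -> 0 <= b -> inLq p f ->
  (Iq p f <= (b `^ p)%:E)%E -> ipr f f <= b ^+ 2.
Proof.
move=> p2 b0 Lf fb; apply: sqr_le_all => // B bB.
have B0 := le_lt_trans b0 bB.
have [_] := inLq_Young p2 B0 Lf; apply; apply: (le_trans fb); rewrite lee_fin.
by apply: ge0_ler_powR; rewrite ?nnegrE ?(ltW bB) ?(ltW B0)//; lra.
Qed.

Lemma nneseries_le (u : R ^nat) b : (forall n, 0 <= u n) ->
  (forall N, \sum_(i < N) u i <= b) -> (\sum_(0 <= n <oo) (u n)%:E <= b%:E)%E.
Proof.
move=> u0 ub; apply: lime_le.
  by apply: is_cvg_nneseries => n _ _; rewrite lee_fin.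
by apply: nearW => N; rewrite sumEFin lee_fin big_mkord.
Qed.

Lemma le_nneseries_fine (u : R ^nat) N : (forall n, 0 <= u n) ->
  (\sum_(0 <= n <oo) (u n)%:E < +oo)%E ->
  \sum_(i < N) u i <= fine (\sum_(0 <= n <oo) (u n)%:E)%E.
Proof.
move=> u0 uy; rewrite -lee_fin fineK; last first.
  by rewrite ge0_fin_numE// nneseries_ge0// => n _ _; rewrite lee_fin.
rewrite -(big_mkord xpredT u) -sumEFin.
by apply: nneseries_lim_ge => n _ _; rewrite lee_fin.
Qed.

End Lqnorm.

(** * The orthogonal projection and the closure of its range *)

Section projection.
Variables (R : realType) (a : R ^nat) (p : R).
Hypothesis a01 : forall n, 0 < a n <= 1.
Hypothesis p2 : 2 < p.
Implicit Types (c d : R ^nat) (f g F : R -> R).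

Let P f := syn a (coef a f).
Let K := Rosenthal_cst p.
Let p0 : 0 < p. Proof. exact: (lt_trans (ltr0n R 2) p2). Qed.
Let K0 : 0 < K. Proof. by have := Rosenthal_cst_gt2 p2; rewrite /K; lra. Qed.

(** [Iq_syn] takes a positive bound [B]; letting [B] decrease to [b] also covers [b = 0]. *)
Lemma Lqnorm_syn c F b : is_syn a c F -> 0 <= b ->
  (forall N, sqsum a c N <= b ^+ 2) ->
  (forall N, \sum_(i < N) a i * `|c i| `^ p <= b `^ p) ->
  inLq p F /\ (Lqnorm p F <= (K * b)%:E)%E.
Proof.
move=> Fc b0 s2 sp.
have h B : b < B -> (Iq p F <= ((K * B) `^ p)%:E)%E.
  move=> bB; have B0 := le_lt_trans b0 bB.
  apply: (Iq_syn a01 p2 Fc B0) => N.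
    apply: (le_trans (s2 N)); rewrite ler_sqr ?nnegrE ?(ltW bB) ?(ltW B0)//.
  apply: (le_trans (sp N)).
  by apply: ge0_ler_powR; rewrite ?nnegrE ?(ltW bB) ?(ltW B0)// ltW.
split.
  have [LF _ _] := Fc; apply: inLqP; first exact: inLq_measurable LF.
  by apply: le_lt_trans (h (b + 1) _) (ltry _); lra.
apply/lee_addgt0Pr => e e0; rewrite -EFinD.
have eK : 0 < e / K by rewrite divr_gt0.
have -> : K * b + e = K * (b + e / K) by field; rewrite gt_eqF.
apply: Lqnorm_le => //; first by rewrite mulr_ge0 ?(ltW K0)//; lra.
by apply: h; lra.
Qed.

Let PP f : inLq 2 f -> is_syn a (coef a f) (P f).
Proof. exact: syn_coefP. Qed.

Let LP f : inLq 2 f -> inLq 2 (P f).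
Proof. by move=> /PP[]. Qed.

Let coefP f : inLq 2 f -> coef a (P f) = coef a f.
Proof. by move=> /PP /(coef_syn a01). Qed.

Let resid f n : inLq 2 f -> ipr (tdiff f (P f)) (tern a n) = 0.
Proof.
move=> Lf; have LPf := LP Lf; have Lt : inLq 2 (tern a n) by exact: inLq_tern.
by rewrite ipr_tdiffl// !(ipr_coef a01) coefP// subrr.
Qed.

Let resid_orth f g : inLq 2 f -> inLq 2 g -> ipr (P f) (tdiff g (P g)) = 0.
Proof.
move=> Lf Lg; have LPg := LP Lg; apply: (is_syn_orth a01 (PP Lf)).
  exact: inLq_tdiff.
by move=> n; exact: resid.
Qed.

Lemma coef_lin (k : R) f g : inLq 2 f -> inLq 2 g ->
  coef a (lin k f g) = fun n => k * coef a f n + coef a g n.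
Proof.
move=> Lf Lg; apply/funext => n; have Lt : inLq 2 (tern a n) by exact: inLq_tern.
by rewrite /coef ipr_linear//; ring.
Qed.

Lemma orth_proj_syn : orth_proj P.
Proof.
split.
- by move=> f /inLqE Lf; apply/inLqE; exact: LP.
- move=> f g /inLqE Lf /inLqE Lg fg.
  suff -> : P f = P g by exact: aeq_refl.
  rewrite /P; congr syn; apply/funext => n; rewrite /coef; congr (_ / _).
  by apply: ipr_aeq => //; exact: inLq_tern.
- move=> k f g /inLqE Lf /inLqE Lg.
  have Llin : inLq 2 (lin k f g) by exact: inLq_linear.
  apply: (is_syn_linear a01 (PP Lf) (PP Lg)).
  by rewrite -coef_lin//; exact: PP.
- move=> f /inLqE Lf; suff -> : P (P f) = P f by exact: aeq_refl.
  by rewrite {1}/P coefP.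
- move=> f g /inLqE Lf /inLqE Lg; have LPf := LP Lf; have LPg := LP Lg.
  rewrite !ipE//; congr (_%:E).
  (* Both sides of the self-adjointness identity equal [ipr (P f) (P g)], since residuals are
     orthogonal to the range. *)
  have := resid_orth Lf Lg; rewrite iprC (ipr_tdiffl Lg LPg LPf).
  move=> /eqP; rewrite subr_eq0 => /eqP h1; rewrite iprC h1 {h1}.
  have := resid_orth Lg Lf; rewrite iprC (ipr_tdiffl Lf LPf LPg).
  by move=> /eqP; rewrite subr_eq0 => /eqP ->; exact: iprC.
Qed.

Lemma Lqnorm_proj f b : inLq 2 f -> inLq p f -> 0 <= b -> Iq p f = (b `^ p)%:E ->
  inLq p (P f) /\ (Lqnorm p (P f) <= (K * b)%:E)%E.
Proof.
move=> Lf Lpf b0 fb; apply: (Lqnorm_syn (PP Lf)) => // N.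
  apply: (le_trans (Bessel a01 N Lf)).
  by apply: (ipr_le_Iq p2) => //; rewrite fb.
by rewrite -lee_fin -fb; exact: coef_powR_le.
Qed.

Lemma p_C_bounded_syn : p_C_bounded p K P.
Proof.
move=> f /inLqE Lf /inLqE Lpf; have [b b0 [-> fb]] := LqnormE p0 Lpf.
by rewrite -EFinM; have [] := Lqnorm_proj Lf Lpf b0 fb.
Qed.

(** Approximation in [L_p] is approximation in [L_2]. The residual [H = g - P g] is orthogonal to
    the range, so [<H, H> = <H, g - P f>] for every [f], and Cauchy-Schwarz bounds the norm of [H]
    by any approximation error. *)
Lemma closure_range_synP g : closure_range p P g ->
  [/\ inLq p g, inLq 2 g & aeq (P g) g].
Proof.
move=> [/inLqE Lpg clg].
have [Lg _] := inLq_Young p2 ltr01 Lpg.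
split => //; have LPg := LP Lg.
pose H := tdiff g (P g).
have LH : inLq 2 H by exact: inLq_tdiff.
suff H0 : ipr H H <= 0.
  apply: aeq_sym; apply: aeq_ipr0 => //.
  by apply/eqP; rewrite eq_le H0 ipr_ge0.
suff : ipr H H <= 0 ^+ 2 by rewrite expr0n.
apply: sqr_le_all => // e e0.
have [f [/inLqE Lf /inLqE Lpf fe]] := clg e e0.
have LPf := LP Lf; have L2d : inLq 2 (tdiff g (P f)) by exact: inLq_tdiff.
have de : ipr (tdiff g (P f)) (tdiff g (P f)) <= e ^+ 2.
  have md := inLq_measurable L2d.
  have : (Lqnorm p (tdiff g (P f)) < e%:E)%E.
    by rewrite (_ : tdiff g (P f) = fun x => g x - P f x)//; apply/funext => x; rewrite tdiffE.
  by move=> /(Lqnorm_lt p0 md)[Lpd]; apply: (ipr_le_Iq p2) => //; exact: ltW.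
have HE : ipr H H = ipr H (tdiff g (P f)).
  have e1 : ipr H H = ipr g H - ipr (P g) H := ipr_tdiffl Lg LPg LH.
  have e2 : ipr (tdiff g (P f)) H = ipr g H - ipr (P f) H := ipr_tdiffl Lg LPf LH.
  have r1 : ipr (P g) H = 0 := resid_orth Lg Lg.
  have r2 : ipr (P f) H = 0 := resid_orth Lf Lg.
  have e3 : ipr H (tdiff g (P f)) = ipr (tdiff g (P f)) H := iprC _ _.
  apply: (etrans e1 (etrans _ (esym (etrans e3 e2)))).
  exact: (congr1 (fun v => ipr g H - v) (etrans r1 (esym r2))).
exact: le_of_sqr_le HE (ipr_Cauchy LH L2d) (ipr_ge0 H) (ipr_ge0 _) de.
Qed.

(** As [F] is the chosen representative, [P F] is [F] itself and approximates it with error 0. *)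
Lemma syn_closure_range c F : is_syn a c F -> syn a c = F -> inLq p F ->
  closure_range p P F.
Proof.
move=> Fc sc LF; split; first exact/inLqE.
have [L2F _ _] := Fc.
move=> e e0; exists F; split; [exact/inLqE|exact/inLqE|].
have PF : P F = F by rewrite /P (coef_syn a01 Fc).
rewrite (_ : (fun x => _) = fun=> 0); last by apply/funext => x; rewrite PF subrr.
by rewrite Lqnorm0// lte_fin.
Qed.

Lemma sqsum_lin_le (k : R) c d N :
  sqsum a (fun n => k * c n + d n) N <= 2 * k ^+ 2 * sqsum a c N + 2 * sqsum a d N.
Proof.
rewrite /sqsum !mulr_sumr -big_split /=; apply: ler_sum => i _.
have a0 : 0 <= a i by have /andP[/ltW] := a01 i.
have := mulr_ge0 a0 (sqr_ge0 (k * c i - d i)); lra.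
Qed.

End projection.

(** * The isomorphism with the sequence space *)

Section weights.
Variables (R : realType) (p : R) (w : R ^nat).
Hypothesis p2 : 2 < p.
Hypothesis w0 : forall n, 0 < w n.
Hypothesis wcvg : w @ \oo --> (0 : R).
Implicit Types (x : R ^nat) (N n : nat).

Let p0 : 0 < p. Proof. exact: (lt_trans (ltr0n R 2) p2). Qed.

(* The [L_2] and [L_p] norms of [tern_n] have ratio [min (w n) 1]. *)
Definition wmass n : R := Num.min (w n) 1 `^ (2 * p / (p - 2)).

Lemma wmin_gt0 n : 0 < Num.min (w n) 1.
Proof. by rewrite lt_min w0 ltr01. Qed.

Lemma wmass01 n : 0 < wmass n <= 1.
Proof.
rewrite powR_gt0 ?wmin_gt0//= -(powRr0 (Num.min (w n) 1)); apply: ger_powR.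
  by rewrite wmin_gt0 ge_min lexx orbT.
by rewrite divr_ge0 ?mulr_ge0 ?(ltW p0)// subr_ge0 ltW.
Qed.

Definition wcoef x n : R := x n * wmass n `^ (- p^-1).

Lemma wcoef_powR x n : wmass n * `|wcoef x n| `^ p = `|x n| `^ p.
Proof.
have /andP[m0 _] := wmass01 n.
rewrite /wcoef normrM (ger0_norm (powR_ge0 _ _)) powRM ?powR_ge0// -powRrM.
by rewrite mulNr mulVf ?gt_eqF// powR_inv1 ?(ltW m0)// mulrCA mulfV ?mulr1 ?gt_eqF.
Qed.

(** The exponent [2p / (p - 2)] is the inverse of [1/2 - 1/p], so [wmass n] to the power [1/2 - 1/p]
    is the truncated weight. *)
Lemma wcoef_sqr x n : wmass n * wcoef x n ^+ 2 = (x n * Num.min (w n) 1) ^+ 2.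
Proof.
have v0 := wmin_gt0 n; have /andP[m0 _] := wmass01 n.
have -> : Num.min (w n) 1 = wmass n `^ (2^-1 - p^-1).
  rewrite /wmass -powRrM.
  have -> : 2 * p / (p - 2) * (2^-1 - p^-1) = 1 by field; rewrite !gt_eqF ?subr_gt0.
  by rewrite powRr1 ?ltW.
rewrite powRB; last by apply/implyP => _; rewrite gt_eqF.
rewrite powR12_sqrt ?(ltW m0)// /wcoef powRN !exprMn sqr_sqrtr ?(ltW m0)//.
by rewrite mulrCA.
Qed.

(** A convergent sequence is bounded, so truncating the weights at 1, which keeps [wmass n] at most
    1, changes the weighted [l_2] norm by at most a constant factor. *)
Lemma wmin_bound : exists2 W : R, 0 < W & forall n, w n <= W * Num.min (w n) 1.
Proof.
have [M [_ wM]] := cvg_seq_bounded (cvgP _ wcvg).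
have {}wM n : w n <= `|M| + 1.
  apply: (le_trans (ler_norm _)); apply: wM => //.
  by rewrite (le_lt_trans (ler_norm _))// ltrDl.
exists (`|M| + 1) => [|n]; first by rewrite ltr_wpDl.
have [w1|w1] := leP (w n) 1; last by rewrite mulr1.
have := normr_ge0 M; have := ltW (w0 n); nra.
Qed.

Lemma sqsum_wcoef_le x N :
  sqsum wmass (wcoef x) N <= \sum_(i < N) (x i * w i) ^+ 2.
Proof.
apply: ler_sum => i _; rewrite wcoef_sqr !exprMn.
apply: ler_wpM2l; first exact: sqr_ge0.
by rewrite ler_sqr ?nnegrE ?(ltW (wmin_gt0 _)) ?(ltW (w0 _))// ge_min lexx.
Qed.

Lemma sum_wcoef_powR x N :
  \sum_(i < N) wmass i * `|wcoef x i| `^ p = \sum_(i < N) `|x i| `^ p.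
Proof. by apply: eq_bigr => i _; rewrite wcoef_powR. Qed.

Lemma Xpw_norm_ge0 x : 0 <= Xpw_norm p w x.
Proof. by rewrite /Xpw_norm le_max powR_ge0. Qed.

Lemma Xpw_sum_powR x N : in_Xpw p w x ->
  \sum_(i < N) `|x i| `^ p <= Xpw_norm p w x `^ p.
Proof.
move=> [xp _].
apply: (le_trans (le_nneseries_fine N (fun n => powR_ge0 _ _) xp)).
set S := fine _; have S0 : 0 <= S.
  by rewrite fine_ge0// nneseries_ge0// => n _ _; rewrite lee_fin powR_ge0.
have -> : S = (S `^ p^-1) `^ p by rewrite -powRrM mulVf ?gt_eqF// powRr1.
apply: ge0_ler_powR; rewrite ?nnegrE ?powR_ge0 ?Xpw_norm_ge0 ?(ltW p0)//.
by rewrite /Xpw_norm le_max -/S lexx.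
Qed.

Lemma Xpw_sum_sqr x N : in_Xpw p w x ->
  \sum_(i < N) (x i * w i) ^+ 2 <= Xpw_norm p w x ^+ 2.
Proof.
move=> [_ x2].
apply: (le_trans (le_nneseries_fine N (fun n => sqr_ge0 _) x2)).
set S := fine _; have S0 : 0 <= S.
  by rewrite fine_ge0// nneseries_ge0// => n _ _; rewrite lee_fin sqr_ge0.
have -> : S = (S `^ 2^-1) ^+ 2 by rewrite powR12_sqrt// sqr_sqrtr.
rewrite ler_sqr ?nnegrE ?powR_ge0 ?Xpw_norm_ge0//.
by rewrite /Xpw_norm le_max -/S lexx orbT.
Qed.

Lemma Xpw_norm_le x (b : R) : 0 <= b ->
  (forall N, \sum_(i < N) `|x i| `^ p <= b `^ p) ->
  (forall N, \sum_(i < N) (x i * w i) ^+ 2 <= b ^+ 2) ->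
  in_Xpw p w x /\ Xpw_norm p w x <= b.
Proof.
move=> b0 xp x2.
have hp := nneseries_le (fun n => powR_ge0 `|x n| p) xp.
have h2 := nneseries_le (fun n => sqr_ge0 (x n * w n)) x2.
have X : in_Xpw p w x by split; [exact: le_lt_trans hp (ltry _)|exact: le_lt_trans h2 (ltry _)].
split => //; rewrite /Xpw_norm ge_max; apply/andP; split.
  have S0 : (0 <= \sum_(0 <= n <oo) (`|x n| `^ p)%:E)%E.
    by rewrite nneseries_ge0// => n _ _; rewrite lee_fin powR_ge0.
  rewrite -[leRHS](powRr1 b0) -(mulfV (negbT (gt_eqF p0))) powRrM.
  apply: ge0_ler_powR; rewrite ?nnegrE ?powR_ge0 ?fine_ge0 ?invr_ge0 ?(ltW p0)//.
  rewrite -lee_fin fineK// ge0_fin_numE//; exact: le_lt_trans hp (ltry _).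
have S0 : (0 <= \sum_(0 <= n <oo) ((x n * w n) ^+ 2)%:E)%E.
  by rewrite nneseries_ge0// => n _ _; rewrite lee_fin sqr_ge0.
rewrite powR12_sqrt ?fine_ge0// -[leRHS](ger0_norm b0) -sqrtr_sqr.
apply: ler_wsqrtr; rewrite -lee_fin fineK// ge0_fin_numE//.
exact: le_lt_trans h2 (ltry _).
Qed.

Local Notation a01 := wmass01.
Local Notation P := (fun f => syn wmass (coef wmass f)).

Lemma wsynP x : in_Xpw p w x -> is_syn wmass (wcoef x) (syn wmass (wcoef x)).
Proof.
move=> Xx; apply: (synP a01 (B := Xpw_norm p w x ^+ 2)) => N.
exact: le_trans (sqsum_wcoef_le x N) (Xpw_sum_sqr N Xx).
Qed.

Lemma Lqnorm_wsyn x : in_Xpw p w x ->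
  inLq p (syn wmass (wcoef x)) /\
  (Lqnorm p (syn wmass (wcoef x)) <= (Rosenthal_cst p * Xpw_norm p w x)%:E)%E.
Proof.
move=> Xx; apply: (Lqnorm_syn a01 p2 (wsynP Xx) (Xpw_norm_ge0 x)) => N.
  exact: le_trans (sqsum_wcoef_le x N) (Xpw_sum_sqr N Xx).
by rewrite sum_wcoef_powR; exact: Xpw_sum_powR.
Qed.

Lemma sum_sqr_wcoef (W : R) x N : 0 < W -> (forall n, w n <= W * Num.min (w n) 1) ->
  \sum_(i < N) (x i * w i) ^+ 2 <= W ^+ 2 * sqsum wmass (wcoef x) N.
Proof.
move=> W0 wW; rewrite /sqsum mulr_sumr; apply: ler_sum => i _.
rewrite wcoef_sqr -exprMn mulrCA !exprMn; apply: ler_wpM2l; first exact: sqr_ge0.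
rewrite -exprMn ler_sqr ?nnegrE ?(ltW (w0 _))//.
by rewrite mulr_ge0 ?(ltW W0)// ltW// wmin_gt0.
Qed.

(** Duality bounds the [l_p] part and Bessel's inequality the [l_2] part. Membership of [x] is a
    conclusion, so the lemma serves both for the lower bound of the isomorphism and for its
    surjectivity. *)
Lemma Xpw_norm_le_Lqnorm (W : R) x F : 1 <= W ->
  (forall n, w n <= W * Num.min (w n) 1) -> inLq 2 F -> inLq p F ->
  coef wmass F = wcoef x ->
  in_Xpw p w x /\ ((W^-1 * Xpw_norm p w x)%:E <= Lqnorm p F)%E.
Proof.
move=> W1 wW L2F LF Fx; have W0 : 0 < W by rewrite (lt_le_trans ltr01).
have [b b0 [-> Ib]] := LqnormE p0 LF.
have [Xx nx] : in_Xpw p w x /\ Xpw_norm p w x <= W * b.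
  apply: Xpw_norm_le => [|N|N]; first by rewrite mulr_ge0 ?(ltW W0).
    rewrite -sum_wcoef_powR -Fx; apply: (@le_trans _ _ (b `^ p)).
      by rewrite -lee_fin -Ib; exact: (coef_powR_le a01).
    apply: ge0_ler_powR; rewrite ?nnegrE ?(ltW p0) ?mulr_ge0 ?(ltW W0)//.
    by rewrite ler_peMl.
  apply: (le_trans (sum_sqr_wcoef x N W0 wW)); rewrite exprMn.
  apply: ler_wpM2l; first exact: sqr_ge0.
  rewrite -Fx; apply: (le_trans (Bessel a01 N L2F)).
  by apply: (ipr_le_Iq p2) => //; rewrite Ib.
by split => //; rewrite lee_fin mulrC ler_pdivrMr// mulrC.
Qed.

Lemma isomorphic_closure_range : isomorphic_Xpw p w (closure_range p P).
Proof.
(* The [l_p] part carries no weight and needs [b <= W b], hence the maximum with 1. *)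
have [W0 W00 wW0] := wmin_bound; pose W := Num.max W0 1.
have W1 : 1 <= W by rewrite le_max lexx orbT.
have W0' : 0 < W by rewrite (lt_le_trans ltr01).
have wW n : w n <= W * Num.min (w n) 1.
  apply: (le_trans (wW0 n)); apply: ler_wpM2r; first exact: ltW (wmin_gt0 n).
  by rewrite le_max lexx.
exists (fun x => syn wmass (wcoef x)), W^-1, (Rosenthal_cst p).
split; first by rewrite invr_gt0.
split; first exact: lt_trans (Rosenthal_cst_gt2 p2).
split.
- move=> x Xx; have [LT _] := Lqnorm_wsyn Xx.
  exact: (syn_closure_range a01 p2 (wsynP Xx)).
- move=> k x y Xx Xy; apply: (is_syn_linear a01 (wsynP Xx) (wsynP Xy)).
  have -> : wcoef (fun n => k * x n + y n) = fun n => k * wcoef x n + wcoef y n.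
    by apply/funext => n; rewrite /wcoef; ring.
  apply: (synP a01 (B := 2 * k ^+ 2 * Xpw_norm p w x ^+ 2 + 2 * Xpw_norm p w y ^+ 2)).
  move=> N; apply: (le_trans (sqsum_lin_le a01 k _ _ N)); apply: lerD.
    apply: ler_wpM2l; first by rewrite mulr_ge0// sqr_ge0.
    exact: le_trans (sqsum_wcoef_le x N) (Xpw_sum_sqr N Xx).
  apply: ler_wpM2l => //.
  exact: le_trans (sqsum_wcoef_le y N) (Xpw_sum_sqr N Xy).
- move=> x Xx; have [LT Tx] := Lqnorm_wsyn Xx; split => //.
  have Ts := wsynP Xx; have [L2T _ _] := Ts.
  have [] := Xpw_norm_le_Lqnorm W1 wW L2T LT (coef_syn a01 Ts).
  by [].
- move=> g /(closure_range_synP a01 p2)[Lg L2g Pg].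
  (* The inverse of the normalisation in [wcoef]; the image of this [x] is then [P g], which equals
     [g] almost everywhere. *)
  pose x n := coef wmass g n * wmass n `^ p^-1.
  have gx : coef wmass g = wcoef x.
    apply/funext => n; rewrite /wcoef /x -mulrA -powRD ?subrr ?powRr0 ?mulr1//.
    by have /andP[m0 _] := wmass01 n; apply/implyP => _; rewrite gt_eqF.
  have [Xx _] := Xpw_norm_le_Lqnorm W1 wW L2g Lg gx.
  by exists x; split => //; rewrite -gx.
Qed.

End weights.

Theorem mainTheorem2 (R : realType) (p : R) (w : R ^nat) :
  2 < p ->
  (forall n, 0 < w n) ->
  w @ \oo --> (0 : R) ->
  (\sum_(0 <= n <oo) ((w n `^ (2 * p / (p - 2)))%:E) = +oo)%E ->
  exists X : set (R -> R),
    orth_complemented p ((735%:R / 100%:R) * (p / ln p)) X /\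
    isomorphic_Xpw p w X.
Proof.
move=> p2 w0 wcvg _; have a01 := wmass01 p2 w0.
exists (closure_range p (fun f => syn (wmass p w) (coef (wmass p w) f))).
split; last exact: isomorphic_closure_range.
exists (fun f => syn (wmass p w) (coef (wmass p w) f)); split => //.
- exact: orth_proj_syn.
- exact: p_C_bounded_syn.
Qed.
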